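(* Let $\mathfrak a=\frac ab$ be a cusp with $\gcd(a,b)=1$, and set $M=\gcd(N,b)$. Assume that either $\gcd(M,N/M)=1$, or else $\gcd(M,N/M)=2$ and $2\,\|\,\frac NM$ (i.e. $2\mid \frac NM$, $4\nmid\frac NM$). Assume further that $\gamma_{\mathfrak a}\in SL(2,\mathbb Z)$ with $\gamma_{\mathfrak a}\infty=\mathfrak a$ is such that for each prime $q\mid N$, with $q^e\,\|\,N$, the matrix $\gamma_{\mathfrak a}$ is congruent modulo $q^e$ to some element of $$\left\{\begin{pmatrix}1&0\\0&1\end{pmatrix},\begin{pmatrix}0&-1\\1&0\end{pmatrix}\right\}\cup\left\{\begin{pmatrix}1&0\\c_1q^l&1\end{pmatrix}\ \Big|\ 1\le l<e,\ \gcd(c_1,q)=1,\ 1\le c_1<\min(q^l,q^{e-l})\right\}.$$ Finally, let $f:\mathfrak h\to\mathbb C$ be any Maass form for $\Gamma_0(N)$ (of weight $k$, type $\nu$ and character $\chi\pmod N$) such that $W_f(g)=\prod_vW_{f,v}(g_v)$ for all $g=\{g_v\}\in GL(2,\mathbb A)$. Then the Fourier coefficients $B(\gamma_{\mathfrak a},\alpha)$ of $f$ at $\mathfrak a$ (defined relative to $\gamma_{\mathfrak a}$) are multiplicative, i.e. $\alpha\mapsto B(\gamma_{\mathfrak a},\alpha)$ is a multiplicative function $\mathbb Q^\times\to\mathbb C$.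
   Context: Classical setup. Let $k\in\mathbb Z$ (weight), $N\ge1$ (level), $\chi$ a Dirichlet character modulo $N$, $\nu\in\mathbb C$ (type), $\mathfrak h$ the upper half plane. For $\gamma=\begin{pmatrix}a&b\\c&d\end{pmatrix}\in GL(2,\mathbb R)$ of positive determinant put $(f|_k\gamma)(z)=\left(\frac{cz+d}{|cz+d|}\right)^{-k}f\left(\frac{az+b}{cz+d}\right)$; for $\gamma\in\Gamma_0(N)$ put $\widetilde\chi(\gamma)=\chi(d)$. Cusps are elements of $\mathbb Q\cup\{\infty\}$ ($\infty=\frac10$). For a cusp $\mathfrak a$ and $\gamma_{\mathfrak a}\in SL(2,\mathbb Z)$ with $\gamma_{\mathfrak a}\infty=\mathfrak a$, the width $m_{\mathfrak a}$ is the least $m\ge1$ with $\gamma_{\mathfrak a}\begin{pmatrix}1&m\\0&1\end{pmatrix}\gamma_{\mathfrak a}^{-1}\in\Gamma_0(N)$; $g_{\mathfrak a}=\gamma_{\mathfrak a}\begin{pmatrix}1&m_{\mathfrak a}\\0&1\end{pmatrix}\gamma_{\mathfrak a}^{-1}$; $\sigma_{\mathfrak a}=\gamma_{\mathfrak a}\begin{pmatrix}\sqrt{m_{\mathfrak a}}&0\\0&\sqrt{m_{\mathfrak a}}^{-1}\end{pmatrix}$; the cusp parameter $0\le\mu_{\mathfrak a}<1$ satisfies $\widetilde\chi(g_{\mathfrak a})=e^{2\pi i\mu_{\mathfrak a}}$. A Maass form of weight $k$, type $\nu$, level $N$, character $\chi$ is a smooth $f:\mathfrak h\to\mathbb C$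 of moderate growth with $f|_k\gamma=\widetilde\chi(\gamma)f$ for $\gamma\in\Gamma_0(N)$, cuspidal ($\int_0^1(f|_k\sigma_{\mathfrak a})(x+iy)dx=0$ for all cusps), with $\Delta_kf=\nu(1-\nu)f$, $\Delta_k=-y^2(\partial_x^2+\partial_y^2)+iky\,\partial_x$. Its Fourier coefficients $A(\mathfrak a,n)$ (depending on $\gamma_{\mathfrak a}$) are defined by $$(f|_k\sigma_{\mathfrak a})(z)=\sum_{n+\mu_{\mathfrak a}\ne0}A(\mathfrak a,n)W_{\frac{\mathrm{sgn}(n+\mu_{\mathfrak a})k}2,\nu-\frac12}(4\pi|n+\mu_{\mathfrak a}|y)e^{2\pi i(n+\mu_{\mathfrak a})x},$$ with $W_{\alpha,\nu}$ the classical Whittaker function. For $\alpha\in\mathbb Q^\times$, $B(\gamma_{\mathfrak a},\alpha):=A(\mathfrak a,m_{\mathfrak a}\alpha-\mu_{\mathfrak a})$ if $m_{\mathfrak a}\alpha-\mu_{\mathfrak a}\in\mathbb Z$, and $:=0$ otherwise (coefficients $A$ defined using $\gamma_{\mathfrak a}$). Multiplicativity. A function $h:\mathbb Q^\times\to\mathbb C$ is multiplicative if there exist $h_\infty:\{\pm1\}\to\mathbb C$ and $h_p:\mathbb Z\to\mathbb C$ for each prime $p$, with $h_p(0)=1$ for all but finitely many $p$, such that $h(\epsilon\prod_pp^{e_p})=h_\infty(\epsilon)\prod_ph_p(e_p)$ for all $\epsilon=\pm1$ and integers $e_p$ almost all $0$. Adelic setup. $\mathbb A$ is the adele ring of $\mathbb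 Q$. $e_\infty(x)=e^{2\pi ix}$, $e_p(x)=e^{-2\pi i\{x\}}$ with $\{x\}$ the $p$-adic fractional part, $e=\prod_ve_v$. The idelic lift $\chi_{\rm idelic}=\prod_v\chi_v$ of $\chi$: if $\chi$ has prime power conductor $p^f$, $\chi_\infty$ is trivial if $\chi(-1)=1$ and the sign character if $\chi(-1)=-1$; $\chi_v(g)=\chi(v)^m$ for $g\in v^m\mathbb Z_v^\times$, $v\ne p$; $\chi_p(g)=\chi(j)^{-1}$ for $g\in p^k(j+p^f\mathbb Z_p)$, $(j,p)=1$ (here $\chi$ denotes the primitive character); in general take the product over the prime-power factors. $K_0(N)=\prod_{p\mid N}I_{p,N}\prod_{p\nmid N}GL(2,\mathbb Z_p)$ with $I_{p,N}=\{\begin{pmatrix}a&b\\c&d\end{pmatrix}\in GL(2,\mathbb Z_p): c\in N\mathbb Z_p\}$, and $\widetilde\chi_{\rm idelic}(k)=\prod_{p\mid N}\chi_p(d_p)$ for $k\in K_0(N)$, $d_p$ the lower right entry of $k_p$. $i_v$ is the embedding of $GL(2,\mathbb Q_v)$ at the place $v$, $i_{\rm diag}$ the diagonal embedding of $GL(2,\mathbb Q)$, $i_{\rm finite}$ the embedding into the finite places. The adelic lift is $f_{\rm adelic}(i_{\rm diag}(\gamma)i_\infty(g_\infty)i_{\rm finite}(k))=(f|_kg_\infty)(i)\,\widetilde\chi_{\rm idelic}(k)$ for $\gamma\in GL(2,\mathbb Q)$, $g_\infty\in GL(2,\mathbb R)^+$, $k\in K_0(N)$. The global Whittaker function is $W_f(g)=\int_{\mathbb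 Q\backslash\mathbb A}f_{\rm adelic}\left(\begin{pmatrix}1&u\\0&1\end{pmatrix}g\right)e(-u)\,du$. Local functions: $W_{f,\infty}(g_\infty)=W_f(i_\infty(g_\infty))$, and for a prime $p$, $W_{f,p}(g_p)=\lim_{y_\infty\to1}W_f\left(i_\infty\begin{pmatrix}y_\infty&0\\0&1\end{pmatrix}i_p(g_p)\right)\Big/W_{\frac k2,\nu-\frac12}(4\pi y_\infty)$. *)

(* Defs.v *)
From HB Require Import structures.
From mathcomp Require Import all_boot all_order all_algebra.
From mathcomp Require Import complex.
From mathcomp Require Import all_classical all_reals all_analysis.

Set Implicit Arguments.
Unset Strict Implicit.
Unset Printing Implicit Defensive.
Import Order.TTheory GRing.Theory Num.Theory.
Import numFieldNormedType.Exports.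

Local Open Scope classical_set_scope.
Local Open Scope ring_scope.
Local Open Scope complex_scope.

Definition prime_t := {p : nat | prime p}.
Coercion prime_val (p : prime_t) : nat := val p.

(* An element of Z_p = lim Z/p^n is the sequence of its residues, the n-th one
   being the representative in [0, p^n) of the class modulo p^n. *)
Definition padic_coherent (p : prime_t) : pred (nat -> int) :=
  fun x => `[< forall n, x n = (x n.+1 %% (p ^ n)%N)%Z >].

Record padic_int (p : prime_t) :=
  PadicInt { residue :> nat -> int ; _ : padic_coherent p residue }.
HB.instance Definition _ p := [isSub for @residue p].
HB.instance Definition _ p := [Choice of padic_int p by <:].

Section PadicIntRing.
Variable p : prime_t.
Implicit Types (x y z : padic_int p) (s t : nat -> int).

Let q n : int := (p ^ n)%N.

Let q_neq0 n : q n != 0.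
Proof. by rewrite /q eqz_nat -lt0n expn_gt0 prime_gt0 ?(valP p). Qed.

Let qS n : (q n %| q n.+1)%Z.
Proof. exact: (dvdn_exp2l p (leqnSn n)). Qed.

Lemma modz_dvdm (m d a : int) : (d %| m)%Z -> ((a %% m)%Z = a %[mod d])%Z.
Proof.
by move=> /dvdzP[c ->]; rewrite [in RHS](divz_eq a (c * d)) mulrA modzMDl.
Qed.

Lemma residueS x n : (x n.+1 %% q n)%Z = x n.
Proof. by case: x => x /= /asboolP h; rewrite [RHS]h. Qed.

Lemma residue_mod x n : (x n %% q n)%Z = x n.
Proof. by rewrite -residueS modz_mod. Qed.

Lemma padic_int_ext x y : (forall n, x n = y n) -> x = y.
Proof. by move=> e; apply: val_inj; apply: funext. Qed.

Lemma reduce_subproof s : (forall n, (s n.+1 = s n %[mod q n])%Z) ->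
  padic_coherent p (fun n => (s n %% q n)%Z).
Proof.
move=> h; apply/asboolP => n.
by rewrite -[in RHS]/(q n) modz_dvdm ?qS.
Qed.

Definition padic_reduce s (h : forall n, (s n.+1 = s n %[mod q n])%Z) :
  padic_int p := PadicInt (reduce_subproof h).

Lemma padic_const_subproof (a : int) :
  forall n, (a = a %[mod q n])%Z.
Proof. by []. Qed.

Lemma padic_add_subproof x y :
  forall n, (x n.+1 + y n.+1 = x n + y n %[mod q n])%Z.
Proof.
by move=> n; rewrite -modzDml -modzDmr !residueS.
Qed.

Lemma padic_opp_subproof x : forall n, (- x n.+1 = - x n %[mod q n])%Z.
Proof. by move=> n; rewrite -modzNm residueS. Qed.

Lemma padic_mul_subproof x y :
  forall n, (x n.+1 * y n.+1 = x n * y n %[mod q n])%Z.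
Proof. by move=> n; rewrite -modzMml -modzMmr !residueS. Qed.

Definition padic_const a := @padic_reduce (fun=> a) (padic_const_subproof a).
Definition padic_add x y :=
  @padic_reduce (fun n => x n + y n) (padic_add_subproof x y).
Definition padic_opp x := @padic_reduce (fun n => - x n) (padic_opp_subproof x).
Definition padic_mul x y :=
  @padic_reduce (fun n => x n * y n) (padic_mul_subproof x y).

Lemma padic_addA : associative padic_add.
Proof.
by move=> x y z; apply: padic_int_ext => n /=; rewrite -!/(q n) modzDmr modzDml addrA.
Qed.

Lemma padic_addC : commutative padic_add.
Proof. by move=> x y; apply: padic_int_ext => n /=; rewrite addrC. Qed.

Lemma padic_add0 : left_id (padic_const 0) padic_add.
Proof.
by move=> x; apply: padic_int_ext => n /=; rewrite -!/(q n) modzDml add0r residue_mod.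
Qed.

Lemma padic_addN : left_inverse (padic_const 0) padic_opp padic_add.
Proof.
by move=> x; apply: padic_int_ext => n /=; rewrite -!/(q n) modzDml addNr.
Qed.

HB.instance Definition _ := GRing.isZmodule.Build (padic_int p)
  padic_addA padic_addC padic_add0 padic_addN.

Lemma padic_mulA : associative padic_mul.
Proof.
by move=> x y z; apply: padic_int_ext => n /=; rewrite -!/(q n) modzMmr modzMml mulrA.
Qed.

Lemma padic_mulC : commutative padic_mul.
Proof. by move=> x y; apply: padic_int_ext => n /=; rewrite mulrC. Qed.

Lemma padic_mul1 : left_id (padic_const 1) padic_mul.
Proof.
by move=> x; apply: padic_int_ext => n /=; rewrite -!/(q n) modzMml mul1r residue_mod.
Qed.

Lemma padic_mulDl : left_distributive padic_mul padic_add.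
Proof.
move=> x y z; apply: padic_int_ext => n /=.
by rewrite -!/(q n) modzMml modzDml modzDmr mulrDl.
Qed.

Lemma padic_1neq0 : padic_const 1 != padic_const 0.
Proof.
apply/eqP => /(congr1 (fun x : padic_int p => x 1)) h.
have : (1 %% q 1)%Z = (0 %% q 1)%Z := h.
by rewrite mod0z /q expn1 modz_small // ltz_nat prime_gt1 ?(valP p).
Qed.

HB.instance Definition _ := GRing.Zmodule_isComNzRing.Build (padic_int p)
  padic_mulA padic_mulC padic_mul1 padic_mulDl padic_1neq0.

Definition padic_unit : pred (padic_int p) := fun x => `[< exists y, y * x = 1 >].
Definition padic_inv x : padic_int p :=
  if pselect (exists y, y * x = 1) is left h then projT1 (cid h) else x.

Lemma padic_mulV : {in padic_unit, left_inverse 1 padic_inv *%R}.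
Proof.
move=> x /asboolP h; rewrite /padic_inv.
by case: pselect => // h'; case: cid.
Qed.

Lemma padic_unitPl x y : y * x = 1 -> padic_unit x.
Proof. by move=> h; apply/asboolP; exists y. Qed.

Lemma padic_inv_out : {in [predC padic_unit], padic_inv =1 id}.
Proof.
move=> x /negP h; rewrite /padic_inv; case: pselect => // h'.
by exfalso; apply: h; apply/asboolP.
Qed.

HB.instance Definition _ := GRing.ComNzRing_hasMulInverse.Build (padic_int p)
  padic_mulV padic_unitPl padic_inv_out.

Lemma residue_le x n m : (n <= m)%N -> (x m %% q n)%Z = x n.
Proof.
elim: m => [|m IH]; first by rewrite leqn0 => /eqP ->; rewrite residue_mod.
rewrite leq_eqVlt => /orP[/eqP ->|]; first by rewrite residue_mod.
rewrite ltnS => nm; rewrite -(IH nm) -(residueS x m) modz_dvdm //.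
exact: (dvdn_exp2l p).
Qed.

Lemma padic_int_neq0 x : x != 0 -> exists n, x n != 0.
Proof.
move=> /eqP x0; apply: contrapT => h; apply: x0; apply: padic_int_ext => n.
by rewrite /= mod0z; apply/eqP; apply: contrapT => /negP xn; apply: h; exists n.
Qed.

Lemma padic_idomain : GRing.integral_domain_axiom (padic_int p).
Proof.
move=> x y xy; apply: contrapT => /negP; rewrite negb_or => /andP[].
move=> /padic_int_neq0[n xn] /padic_int_neq0[m ym].
have pp := valP p.
have nz (z : padic_int p) a b : (a <= b)%N -> z a != 0 ->
    exists2 k, z b = k%:Z & (0 < k)%N && (logn p k < a)%N.
  move=> ab; rewrite -(residue_le z ab) => za.
  have zb : 0 <= z b by rewrite -residue_mod modz_ge0.
  exists `|z b|%N; first by rewrite gez0_abs.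
  have k0 : (0 < `|z b|)%N.
    by rewrite lt0n absz_eq0; apply: contraNneq za => ->; rewrite mod0z.
  rewrite k0 ltnNge; apply: contra za => la.
  apply/eqP/dvdz_mod0P; rewrite -[(_ %| _)%Z]/(p ^ a %| `|z b|)%N.
  by rewrite pfactor_dvdn.
have [k xk /andP[k0 kn]] := nz x n (n + m)%N (leq_addr _ _) xn.
have [l yl /andP[l0 lm]] := nz y m (n + m)%N (leq_addl _ _) ym.
have := congr1 (fun z : padic_int p => z (n + m)%N) xy.
rewrite /= mod0z xk yl => /dvdz_mod0P; rewrite -PoszM -[(_ %| _)%Z]/(p ^ (n + m) %| k * l)%N.
rewrite pfactor_dvdn ?muln_gt0 ?k0 //.
by rewrite lognM // leqNgt -addnS leq_add // ltnW.
Qed.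

HB.instance Definition _ := GRing.ComUnitRing_isIntegral.Build (padic_int p)
  padic_idomain.

End PadicIntRing.

Notation padic p := {fraction (padic_int p)}.

Definition to_padic (p : prime_t) (z : padic_int p) : padic p := tofrac z.

Definition is_padic_int (p : prime_t) : set (padic p) := range (@to_padic p).

Definition is_padic_unit (p : prime_t) : set (padic p) :=
  [set to_padic z | z in [set z : padic_int p | z \is a GRing.unit]].
Arguments is_padic_int : clear implicits.
Arguments is_padic_unit : clear implicits.

Definition padic_frac (p : prime_t) (x : padic p) : rat :=
  xget 0 [set r : rat | [/\ 0 <= r < 1,
    exists n : nat, r * (p ^ n)%:R \is a Num.int &
    is_padic_int p (x - ratr r)]].

Definition Zhat := forall p : prime_t, padic_int p.
HB.instance Definition _ := gen_eqMixin Zhat.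
HB.instance Definition _ := gen_choiceMixin Zhat.
HB.instance Definition _ := isPointed.Build Zhat (fun=> 0).

Definition Zhat_cylinders : set (set Zhat) :=
  [set A | exists (p : prime_t) (n : nat) (r : int), A = [set z : Zhat | z p n = r]].

(* The cylinders generate the Borel sigma-algebra of the profinite topology. *)
Definition Zhat_borel := g_sigma_algebraType Zhat_cylinders.

Definition is_haar (R : realType) (mu : probability Zhat_borel R) :=
  forall (a : Zhat) (A : set Zhat_borel), measurable A ->
    mu [set (fun p => a p + z p) | z in A] = mu A.

Local Notation cRe := complex.Re.
Local Notation cIm := complex.Im.

Definition mx2 (K : Type) (a b c d : K) : 'M[K]_2 :=
  \matrix_(i < 2, j < 2)
    if i == 0 then (if j == 0 then a else b) else (if j == 0 then c else d).

(* Derivatives and integrals of functions with values in R[i] are taken on real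
   and imaginary parts. *)
Section ComplexCalculus.
Variable R : realType.

(* R[i]^o carries the library's topology of the field R[i]. *)
Definition Ccvg (T : Type) (F : set_system T) (u : T -> R[i]^o) (l : R[i]^o) :=
  u t @[t --> F] --> l.

Definition Clim (T : Type) (F : set_system T) (u : T -> R[i]^o) : R[i] :=
  lim (u t @[t --> F]).

Definition Cderivable (g : R -> R[i]) (t : R) :=
  derivable (fun s => cRe (g s)) t 1 /\ derivable (fun s => cIm (g s)) t 1.

Definition Cderive (g : R -> R[i]) (t : R) : R[i] :=
  derive1 (fun s => cRe (g s)) t +i* derive1 (fun s => cIm (g s)) t.

Definition Cintegral d (T : measurableType d) (mu : {measure set T -> \bar R})
    (D : set T) (h : T -> R[i]) : R[i] :=
  (\int[mu]_(x in D) cRe (h x)) +i* (\int[mu]_(x in D) cIm (h x)).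

(* An unordered sum: the terms are absolutely summable with sum l. *)
Definition Csum_int (u : int -> R[i]) (l : R[i]) :=
  summable [set: int] (fun n => (cRe `|u n|)%:E) /\
  Ccvg \oo (fun m : nat => \sum_(i < m.*2.+1) u (i%:Z - m%:Z)) l.

Definition e2pi (x : R) : R[i] := cos (2 * pi * x) +i* sin (2 * pi * x).

Definition pdx (F : R -> R -> R[i]) : R -> R -> R[i] :=
  fun x y => Cderive (fun s => F s y) x.
Definition pdy (F : R -> R -> R[i]) : R -> R -> R[i] :=
  fun x y => Cderive (F x) y.

(* All iterated partial derivatives, in any order, exist and are continuous on
   the upper half plane. *)
Definition smooth (F : R -> R -> R[i]) :=
  forall (s : seq bool) (x y : R), 0 < y ->
  let G := foldr (fun b H => if b then pdx H else pdy H) F s in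
  [/\ Cderivable (fun t => G t y) x, Cderivable (G x) y &
      {for (x, y), continuous (fun q : R * R => G q.1 q.2 : R[i]^o)}].

(* The classical W_{al,nu} on the positive reals is determined by Whittaker's
   equation together with its behaviour exp(- y/2) y^al at infinity. *)
Record is_whittaker (al : R) (nu : R[i]) (w : R -> R[i]) : Prop := IsWhittaker {
  whittaker_derivable : forall y, 0 < y ->
    Cderivable w y /\ Cderivable (Cderive w) y;
  whittaker_eq : forall y, 0 < y ->
    Cderive (Cderive w) y
    + (- 4^-1 + (al / y)%:C + (4^-1 - nu ^+ 2) / (y ^+ 2)%:C) * w y = 0;
  whittaker_infty :
    Ccvg +oo%R (fun y => w y * (expR (y / 2) * y `^ (- al))%:C) 1
}.

Definition slash (k : int) (g : 'M[R]_2) (f : R[i] -> R[i]) (z : R[i]) : R[i] :=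
  let j := (g 1 0)%:C * z + (g 1 1)%:C in
  (j / `|j|) ^ (- k) * f (((g 0 0)%:C * z + (g 0 1)%:C) / j).

Record dirichlet_char (N : nat) := DirichletChar {
  dchar :> int -> R[i];
  dchar_mod : forall a b, (a = b %[mod N])%Z -> dchar a = dchar b;
  dchar1 : dchar 1 = 1;
  dcharM : forall a b, dchar (a * b) = dchar a * dchar b;
  dchar_neq0 : forall a, (dchar a != 0) = coprimez a N
}.

End ComplexCalculus.

Definition SL2Z : set 'M[int]_2 := [set g | \det g = 1].

Definition Gamma0 (N : nat) (g : 'M[int]_2) : bool :=
  (\det g == 1) && (N%:Z %| g 1%R 0%R)%Z.

Definition cusp_conj (gam : 'M[int]_2) (m : nat) : 'M[int]_2 :=
  gam *m mx2 1 m%:Z 0 1 *m invmx gam.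

(* The least admissible m >= 1; m = N is always admissible, so searching up to N
   suffices. *)
Definition cusp_width (N : nat) (gam : 'M[int]_2) : nat :=
  \big[minn/N]_(1 <= m < N.+1 | Gamma0 N (cusp_conj gam m)) m.

Definition cusp_gen (N : nat) (gam : 'M[int]_2) : 'M[int]_2 :=
  cusp_conj gam (cusp_width N gam).

Section MaassForms.
Variables (R : realType) (N : nat) (chi : dirichlet_char R N).

Definition int_mx (g : 'M[int]_2) : 'M[R]_2 := map_mx intr g.

Definition cusp_scaling (gam : 'M[int]_2) : 'M[R]_2 :=
  let s := Num.sqrt (cusp_width N gam)%:R in
  int_mx gam *m mx2 s 0 0 s^-1.

Definition cusp_param (gam : 'M[int]_2) : R :=
  xget 0 [set mu : R | 0 <= mu < 1 /\ chi (cusp_gen N gam 1 1) = e2pi mu].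

(* The condition at the cusp concerns the constant term, which exists only where
   the cusp parameter vanishes; elsewhere f|sigma is not 1-periodic in x. *)
Record is_maass (k : int) (nu : R[i]) (f : R[i] -> R[i]) : Prop := IsMaass {
  maass_smooth : smooth (fun x y => f (x +i* y));
  maass_growth : forall gam, SL2Z gam -> exists (c : R) (B : nat) (y0 : R),
    forall x y, 0 < y -> y0 <= y ->
      cRe `|slash k (cusp_scaling gam) f (x +i* y)| <= c * y ^+ B;
  maass_slash : forall gam z, Gamma0 N gam -> 0 < cIm z ->
    slash k (int_mx gam) f z = chi (gam 1 1) * f z;
  maass_cusp : forall gam y, SL2Z gam -> cusp_param gam = 0 -> 0 < y ->
    Cintegral lebesgue_measure `[0, 1]
      (fun x => slash k (cusp_scaling gam) f (x +i* y)) = 0;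
  maass_eigen : forall x y, 0 < y ->
    let F x y := f (x +i* y) in
    - (y ^+ 2)%:C * (pdx (pdx F) x y + pdy (pdy F) x y)
    + 'i%C * k%:~R * y%:C * pdx F x y = nu * (1 - nu) * F x y
}.

Variable W : R -> R[i] -> R -> R[i].

Definition is_fourier (k : int) (nu : R[i]) (f : R[i] -> R[i])
    (gam : 'M[int]_2) (A : int -> R[i]) :=
  forall x y, 0 < y ->
  Csum_int (fun n => let t := n%:~R + cusp_param gam in
      if t == 0 then 0 else
      A n * W (Num.sg t * k%:~R / 2) (nu - 2^-1) (4 * pi * `|t| * y)
          * e2pi (t * x))
    (slash k (cusp_scaling gam) f (x +i* y)).

Definition fourierB (gam : 'M[int]_2) (A : int -> R[i]) (al : rat) : R[i] :=
  let t := (cusp_width N gam)%:R * ratr al - cusp_param gam in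
  if t \is a Num.int then A (Num.floor t) else 0.

End MaassForms.

Definition primes_below (n : nat) : seq prime_t := pmap insub (iota 0 n).
Definition primes_of (N : nat) : seq prime_t := pmap insub (primes N).

Record adele (R : realType) :=
  Adele { adele_inf : R ; adele_fin : forall p, padic p }.

Record adelic_mx (R : realType) :=
  AdelicMx { mx_inf : 'M[R]_2 ; mx_fin : forall p, 'M[padic p]_2 }.

Definition GL2Zp (p : prime_t) : set 'M[padic p]_2 :=
  [set g : 'M[padic p]_2 | (forall i j, is_padic_int p (g i j)) /\ is_padic_unit p (\det g)].
Arguments GL2Zp : clear implicits.

Definition K0 (N : nat) : set (forall p, 'M[padic p]_2) :=
  [set g | forall p, GL2Zp p (g p) /\
    ((p %| N)%N -> exists z : padic_int p, g p 1 0 = N%:R * to_padic z)].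

Section AdelicLift.
Variable R : realType.

Definition GL2A : set (adelic_mx R) :=
  [set g | [/\ \det (mx_inf g) != 0, forall p, \det (mx_fin g p) != 0 &
               finite_set [set p | ~ GL2Zp p (mx_fin g p)]]].

Definition adelic_mul (g h : adelic_mx R) : adelic_mx R :=
  AdelicMx (mx_inf g *m mx_inf h) (fun p => mx_fin g p *m mx_fin h p).

Definition i_inf (g : 'M[R]_2) : adelic_mx R := AdelicMx g (fun=> 1).
Definition i_fin (g : forall p, 'M[padic p]_2) : adelic_mx R := AdelicMx 1 g.
Definition i_at (p : prime_t) (g : 'M[padic p]_2) : adelic_mx R :=
  i_fin (@dfwith _ (fun r => 'M[padic r]_2) (fun=> 1) p g).
Definition i_diag (g : 'M[rat]_2) : adelic_mx R :=
  AdelicMx (map_mx ratr g) (fun p => map_mx ratr g).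

Definition unipotent (u : adele R) : adelic_mx R :=
  AdelicMx (mx2 1 (adele_inf u) 0 1) (fun p => mx2 1 (adele_fin u p) 0 1).

Definition adele_opp (u : adele R) : adele R :=
  Adele (- adele_inf u) (fun p => - adele_fin u p).

Definition e_at (p : prime_t) (x : padic p) : R[i] :=
  e2pi (- ratr (padic_frac x)).

Definition e_adele (u : adele R) : R[i] :=
  e2pi (adele_inf u) *
  \big[*%R/1]_(p \in [set: prime_t]) e_at (adele_fin u p).

Variables (N : nat) (chi : dirichlet_char R N).

(* The factor of chi of modulus q^e || N: its value at j prime to q is that of
   chi at an integer congruent to j mod q^e and to 1 mod N/q^e.  At such j it
   agrees with the primitive character inducing it, and it is only used there. *)
Definition dchar_part (q : nat) (j : int) : R[i] :=
  let d := (q ^ logn q N)%N in chi (zchinese d%:Z (N %/ d)%N%:Z j 1).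

(* The component at p of the idelic lift of chi, at g in p^m (j + p^e Z_p) with
   p^e || N: the q-primary factor of chi contributes its value at p^m if q <> p,
   and the inverse of its value at j if q = p.  (If p does not divide N, the
   factor at p is the trivial character.) *)
Definition chi_idelic (p : prime_t) (g : padic p) : R[i] :=
  xget 0 [set w | exists (m j : int) (z : padic_int p),
    [/\ coprimez j p,
        g = p%:R ^ m * (j%:~R + (p ^ logn p N)%:R * to_padic z) &
        w = (dchar_part p j)^-1
            * \prod_(q <- primes N | q != p) dchar_part q p ^ m]].

Definition chi_K0 (g : forall p, 'M[padic p]_2) : R[i] :=
  \prod_(p <- primes_of N) chi_idelic (g p 1 1).

Definition adelic_lift (k : int) (f : R[i] -> R[i]) (g : adelic_mx R) : R[i] :=
  xget 0 [set w | exists (gam : 'M[rat]_2) (ginf : 'M[R]_2) kap,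
    [/\ \det gam != 0, 0 < \det ginf, K0 N kap,
        g = adelic_mul (adelic_mul (i_diag gam) (i_inf ginf)) (i_fin kap) &
        w = slash k ginf f 'i * chi_K0 kap]].

Variable mu : probability Zhat_borel R.
Variables (k : int) (f : R[i] -> R[i]).

(* Q\A is integrated over its fundamental domain [0,1) x Zhat. *)
Definition whittaker_fun (g : adelic_mx R) : R[i] :=
  Cintegral mu setT (fun z : Zhat_borel =>
    Cintegral lebesgue_measure `[0, 1[ (fun x =>
      let u := Adele x (fun p => to_padic (z p)) in
      adelic_lift k f (adelic_mul (unipotent u) g) * e_adele (adele_opp u))).

Variables (W : R -> R[i] -> R -> R[i]) (nu : R[i]).

Definition whittaker_at (p : prime_t) (g : 'M[padic p]_2) : R[i] :=
  Clim (1 : R)^' (fun y =>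
    whittaker_fun (adelic_mul (i_inf (mx2 y 0 0 1)) (i_at g))
    / W (k%:~R / 2) (nu - 2^-1) (4 * pi * y)).

(* The product over all places is the limit of its partial products. *)
Definition whittaker_factors :=
  forall g, GL2A g ->
  Ccvg \oo (fun n => whittaker_fun (i_inf (mx_inf g))
                     * \prod_(p <- primes_below n) whittaker_at (mx_fin g p))
    (whittaker_fun g).

End AdelicLift.

(* Only the values of h at nonzero rationals matter. *)
Definition multiplicative_rat (R : realType) (h : rat -> R[i]) :=
  exists (hinf : int -> R[i]) (hp : prime_t -> int -> R[i]),
    finite_set [set p | hp p 0 != 1] /\
    forall (eps : int) (e : prime_t -> int), eps = 1 \/ eps = -1 ->
      finite_set [set p | e p != 0] ->
      h (eps%:~R * \big[*%R/1]_(p \in [set: prime_t]) (((prime_val p)%:R : rat) ^ e p)) =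
      hinf eps * \big[*%R/1]_(p \in [set: prime_t]) hp p (e p).

Definition mx_congr (m : nat) (g h : 'M[int]_2) :=
  forall i j, (g i j = h i j %[mod m])%Z.

Definition cusp_reps (q e : nat) : set 'M[int]_2 :=
  [set 1; mx2 0 (-1) 1 0] `|`
  [set g | exists c l : nat, [/\ (1 <= l < e)%N, coprime c q,
     (1 <= c < minn (q ^ l) (q ^ (e - l)))%N &
     g = mx2 1 0 (c * q ^ l)%N%:Z 1]].

(* Main.v *)
Require Import Defs.
From HB Require Import structures.
From mathcomp Require Import all_boot all_order all_algebra.
From mathcomp Require Import complex.
From mathcomp Require Import all_classical all_reals all_analysis.
From mathcomp Require Import cyclic measurable_realfun.
From mathcomp Require Import ring lra zify.

Set Implicit Arguments.
Unset Strict Implicit.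
Unset Printing Implicit Defensive.
Import Order.TTheory GRing.Theory Num.Theory.
Import numFieldNormedType.Exports.

Local Open Scope classical_set_scope.
Local Open Scope ring_scope.
Local Open Scope complex_scope.

(** Write d(x) = diag(x, 1). Unfolding the adelic lift at the point with real component
    d(al y) and finite components d(al) gam^-1 kap_p, where kap is in K_0(N), shows that
    the global Whittaker function there equals
      chi(kap) B(gam, al) W(4 pi |al| y):
    on each residue class of the variable in Zhat the integrand is a translate of the
    Fourier expansion of f at the cusp, and averaging over the classes selects the
    exponent al. Let u_p be the p-unit part of al. Conjugating d(u_p^-1) by gam gives
    kap_p in K_0(N) for every p | N; this is where the hypotheses on M and on gam enter,
    since for gam = [1, 0; c, 1] modulo p^e it requires c (u_p - 1) = 0 modulo p^e. With
    this kap the p-component becomes d(p^(e_p)) gam^-1, respectively d(p^(e_p)) when p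
    does not divide N, so the factorisation of the Whittaker function exhibits B(gam, al)
    as a product of functions of the single exponents e_p; the factor chi(kap) is
    multiplicative in al as well. The local factor w at d(1) is the same for all p; if
    w <> 1, convergence of the infinite product forces the Whittaker function, hence
    B(gam, .), to vanish. *)

(** * p-adic integers and numbers *)

(** The factorisation enters as a black box: no local Whittaker function is computed. What matters
    is that the real component depends on the sign eps alone and the p-component on e_p alone. The
    size of al would spoil the former, so the expansion is evaluated at height y / |al|; y is chosen
    once per sign, at a point where the Whittaker function does not vanish, so that one can divide
    by its value.

    The character does not split prime by prime at first: chi_p(u_p) involves the powers of all
    primes q other than p. Since chi_p is multiplicative on units, the double product over p | N and
    q can be regrouped by q, and the powers chi_p(q)^(e_q) go into the function at q.

    The case w <> 1 has to be separated because multiplicativity asks for h_p(0) = 1 at almost all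
    p.

    The finite part of the integral over Q\A reduces to a finite sum: for a modulus D depending on
    al, the inner integral depends only on the coset of D Zhat, and the D cosets have equal mass by
    translation invariance. *)

Lemma modz_eq_dvd (a b d : int) : (a = b %[mod d])%Z <-> (d %| a - b)%Z.
Proof. by rewrite -eqz_mod_dvd; split=> /eqP. Qed.

Section PadicIntegers.
Variable p : prime_t.
Implicit Types (x y : padic_int p) (a : int) (n : nat).

Let pP : prime p := valP p.

Lemma expp_gt0 n : (0 < p ^ n)%N. Proof. by rewrite expn_gt0 prime_gt0. Qed.

Lemma padic_const_intr a : a%:~R = padic_const p a.
Proof.
have addc b c : padic_const p (b + c) = padic_const p b + padic_const p c.
  by apply: padic_int_ext => n /=; rewrite modzDmr modzDml.
have natc n : n%:~R = padic_const p n.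
  elim: n => [|n IH].
    by apply: padic_int_ext => n.
  by rewrite -pmulrn -natr1 -addn1 PoszD addc -IH -pmulrn.
case: a => n; first exact: natc.
rewrite NegzE mulrNz natc; apply/eqP; rewrite eq_sym -addr_eq0 -addc.
by rewrite addNr; apply/eqP/padic_int_ext.
Qed.

Lemma residue_intr a n : (a%:~R : padic_int p) n = (a %% (p ^ n)%N)%Z.
Proof. by rewrite padic_const_intr. Qed.

Lemma residue1 n : (1 : padic_int p) n = (1 %% (p ^ n)%N)%Z.
Proof. by []. Qed.

Lemma residueD x y n : (x + y) n = ((x n + y n) %% (p ^ n)%N)%Z.
Proof. by []. Qed.

Lemma residueM x y n : (x * y) n = ((x n * y n) %% (p ^ n)%N)%Z.
Proof. by []. Qed.

Lemma residueB x y n : (x - y) n = ((x n - y n) %% (p ^ n)%N)%Z.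
Proof. by rewrite residueD /= modzDmr. Qed.

(** Dividing by p^n loses n digits, so the m-th residue of the quotient is read off from [x] at
    level [m + n]. *)
Lemma padic_dvd_exp x n : x n = 0 -> exists y, x = (p ^ n)%:R * y.
Proof.
move=> xn0.
have dv m : (((p ^ n)%N : int) %| x (m + n)%N)%Z.
  by apply/dvdz_mod0P; rewrite residue_le ?leq_addl.
have h m : (divz (x (m.+1 + n)%N) (p ^ n)%N =
      divz (x (m + n)%N) (p ^ n)%N %[mod (p ^ m)%N])%Z.
  have /dvdzP[c hc] : (((p ^ (m + n))%N : int) %| x (m.+1 + n)%N - x (m + n)%N)%Z.
    by apply/modz_eq_dvd; rewrite residue_mod addSn residueS.
  have -> : x (m.+1 + n)%N = c * (p ^ m)%N%:Z * (p ^ n)%N + x (m + n)%N.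
    by rewrite -mulrA -PoszM -expnD -hc subrK.
  by rewrite divzMDl ?modzMDl // eqz_nat -lt0n expp_gt0.
exists (padic_reduce h); apply: padic_int_ext => m.
rewrite pmulrn residueM residue_intr /= modzMml modzMmr mulrC divzK //.
by rewrite residue_le ?leq_addr.
Qed.

Lemma padic_approx x n : exists y, x = (x n)%:~R + (p ^ n)%:R * y.
Proof.
have [|y e] := @padic_dvd_exp (x - (x n)%:~R) n.
  by rewrite residueB residue_intr residue_mod subrr mod0z.
by exists y; rewrite -e addrC subrK.
Qed.

Lemma coprimez_expp a n : coprimez a p -> coprimez a (p ^ n)%N.
Proof. by rewrite !coprimezE; apply: coprimeXr. Qed.

Lemma coprimez_prime a : coprimez a p = ~~ (p%:Z %| a)%Z.
Proof.
by rewrite coprimezE coprime_sym prime_coprime.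
Qed.

(** For the converse, Bezout gives an inverse modulo each p^n, and uniqueness of inverses modulo p^n
    makes these coherent. *)
Lemma padic_unitE x : (x \is a GRing.unit) = (x 1%N != 0).
Proof.
apply/idP/idP => [/mulVr /(congr1 (fun z : padic_int p => z 1%N))|x1].
  rewrite residueM => h; apply/eqP => x0; move: h; rewrite x0 mulr0 mod0z.
  by rewrite -[1]/(1%:~R) residue_intr modz_small //= expn1 ltz_nat prime_gt1.
have cop n : coprimez (x n) (p ^ n)%N.
  case: n => [|n]; first by rewrite expn0 coprimezE coprimen1.
  apply: coprimez_expp; rewrite coprimez_prime; apply: contra x1 => h.
  by rewrite -(@residue_le _ x 1 n.+1) // expn1; apply/eqP/dvdz_mod0P.
pose y n := (egcdz (x n) (p ^ n)%N).1.
have yE n : (y n * x n = 1 %[mod (p ^ n)%N])%Z.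
  rewrite /y; case: egcdzP => u v /= e _; apply/modz_eq_dvd/dvdzP; exists (- v).
  by move/eqP: (cop n) => e'; rewrite -e' -e mulNr opprD addNKr.
have h n : (y n.+1 = y n %[mod (p ^ n)%N])%Z.
  apply/modz_eq_dvd; rewrite -(@Gauss_dvdzl _ _ (x n)); last first.
    by rewrite coprimez_sym.
  have [/modz_eq_dvd d1 /modz_eq_dvd d2] := (yE n, yE n.+1).
  have d2' : (((p ^ n)%N : int) %| y n.+1 * x n.+1 - 1)%Z.
    by apply: dvdz_trans d2; exact: (dvdn_exp2l p (leqnSn n)).
  have d3 : (((p ^ n)%N : int) %| x n.+1 - x n)%Z.
    by apply/modz_eq_dvd; rewrite residueS residue_mod.
  have -> : (y n.+1 - y n) * x n = (y n.+1 * x n.+1 - 1) - (y n * x n - 1)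
     - y n.+1 * (x n.+1 - x n) by ring.
  by apply: rpredB; [exact: rpredB|exact: dvdz_mull].
apply/unitrPr; exists (padic_reduce h); apply: padic_int_ext => n.
by rewrite residueM /= modzMmr mulrC yE.
Qed.

Lemma padic_unit_intr a : ((a%:~R : padic_int p) \is a GRing.unit) = coprimez a p.
Proof.
rewrite padic_unitE residue_intr expn1 coprimez_prime; congr (~~ _).
by apply/idP/idP => [/eqP/dvdz_mod0P|/dvdz_mod0P/eqP].
Qed.

(** A nonzero [a] is already detected at level |a|, because |a| < p^|a|. *)
Lemma padic_intr_eq0 a : ((a%:~R : padic_int p) == 0) = (a == 0).
Proof.
apply/eqP/eqP => [h|->//]; apply/eqP; rewrite -absz_eq0 -leqn0 leqNgt.
apply/negP => a0; have := congr1 (fun z : padic_int p => z `|a|%N) h.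
rewrite residue_intr /= mod0z => /dvdz_mod0P /(dvdn_leq a0); rewrite leqNgt.
by rewrite ltn_expl ?prime_gt1.
Qed.
End PadicIntegers.

Section PadicField.
Variable p : prime_t.
Implicit Types (x y : padic p) (a : int) (r s : rat).

Lemma padic_intrF_eq0 a : ((a%:~R : padic p) == 0) = (a == 0).
Proof. by rewrite -(rmorph_int (@tofrac (padic_int p))) tofrac_eq0 padic_intr_eq0. Qed.

(* In the library [ratr] is a ring morphism only into a [numFieldType]. *)
Definition qp r : padic p := ratr r.

Lemma qp_int a : qp a%:~R = a%:~R. Proof. exact: ratr_int. Qed.

(** Any denominator may be used, not only the reduced one; the morphism laws below then follow by
    multiplying denominators. *)
Lemma qp_spec r a b : b != 0 -> r * b%:~R = a%:~R -> qp r * b%:~R = a%:~R.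
Proof.
move=> b0 e; rewrite /qp /ratr mulrAC -(divr1 a%:~R).
apply/eqP; rewrite eqr_div ?padic_intrF_eq0 ?denq_neq0 ?oner_eq0 // mulr1 -!intrM.
rewrite -subr_eq0 -intrB padic_intrF_eq0 subr_eq0 -(eqr_int rat) !intrM -e mulrAC.
by rewrite -{2}(divq_num_den r) divfK // intr_eq0 denq_neq0.
Qed.

Lemma qp_zmod : zmod_morphism qp.
Proof.
move=> r s; have d0 u : (denq u)%:~R != 0 :> padic p.
  by rewrite padic_intrF_eq0 denq_neq0.
have D0 u : (denq u)%:~R != 0 :> rat by rewrite intr_eq0 denq_neq0.
have e u : qp u * (denq u)%:~R = (numq u)%:~R by rewrite /qp /ratr divfK ?d0.
apply: (mulIf (mulf_neq0 (d0 r) (d0 s))); rewrite -intrM.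
rewrite (qp_spec (a := numq r * denq s - numq s * denq r)) ?mulf_neq0 ?denq_neq0 //.
  by rewrite intrB !intrM -!e; ring.
by rewrite intrB !intrM !numqE; ring.
Qed.

Lemma qp_monoid : monoid_morphism qp.
Proof.
split=> [|r s]; first exact: (qp_int 1).
have d0 u : (denq u)%:~R != 0 :> padic p.
  by rewrite padic_intrF_eq0 denq_neq0.
have e u : qp u * (denq u)%:~R = (numq u)%:~R by rewrite /qp /ratr divfK ?d0.
apply: (mulIf (mulf_neq0 (d0 r) (d0 s))); rewrite -intrM.
rewrite (qp_spec (a := numq r * numq s)) ?mulf_neq0 ?denq_neq0 //.
  by rewrite !intrM -!e; ring.
by rewrite !intrM !numqE; ring.
Qed.

HB.instance Definition _ := GRing.isZmodMorphism.Build rat (padic p) qp qp_zmod.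
HB.instance Definition _ := GRing.isMonoidMorphism.Build rat (padic p) qp qp_monoid.

Notation Zp := (is_padic_int p).

HB.instance Definition _ := GRing.RMorphism.copy (@to_padic p) (@tofrac (padic_int p)).

Lemma Zp_to (z : padic_int p) : Zp (to_padic z). Proof. by exists z. Qed.

Lemma Zp_int a : Zp a%:~R.
Proof. by exists a%:~R => //; rewrite rmorph_int. Qed.

Lemma Zp_nat n : Zp n%:R. Proof. exact: (Zp_int n). Qed.

Lemma Zp0 : Zp 0. Proof. exact: (Zp_int 0). Qed.
Lemma Zp1 : Zp 1. Proof. exact: (Zp_int 1). Qed.

Lemma ZpD x y : Zp x -> Zp y -> Zp (x + y).
Proof. by move=> [a _ <-] [b _ <-]; exists (a + b) => //; rewrite rmorphD. Qed.

Lemma ZpN x : Zp x -> Zp (- x).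
Proof. by move=> [a _ <-]; exists (- a) => //; rewrite rmorphN. Qed.

Lemma ZpB x y : Zp x -> Zp y -> Zp (x - y).
Proof. by move=> hx hy; apply: ZpD => //; apply: ZpN. Qed.

Lemma ZpM x y : Zp x -> Zp y -> Zp (x * y).
Proof. by move=> [a _ <-] [b _ <-]; exists (a * b) => //; rewrite rmorphM. Qed.

Lemma to_padic_inj : injective (@to_padic p).
Proof. by move=> x y /eqP; rewrite /to_padic tofrac_eq => /eqP. Qed.

Lemma Zp_unitP x : is_padic_unit p x <-> [/\ x != 0, Zp x & Zp x^-1].
Proof.
split=> [[z zu <-]|[x0 [z _ zx] [w _ wx]]].
  split; [|exact: Zp_to|exists z^-1 => //].
    rewrite /to_padic tofrac_eq0; apply/eqP => z0.
    by move: zu => /=; rewrite z0 unitr0.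
  by rewrite rmorphV.
exists z => //=; apply/unitrP; exists w; have wz : w * z = 1.
  by apply: to_padic_inj; rewrite rmorphM rmorph1 /= zx wx mulVf.
by split=> //; rewrite mulrC.
Qed.

Lemma Zp_unitM x y : is_padic_unit p x -> is_padic_unit p y -> is_padic_unit p (x * y).
Proof.
move=> /Zp_unitP[x0 zx vx] /Zp_unitP[y0 zy vy]; apply/Zp_unitP.
split.
- exact: (mulf_neq0 x0 y0).
- exact: (ZpM zx zy).
- have -> : (x * y)^-1 = x^-1 * y^-1 by apply: invfM.
  exact: (ZpM vx vy).
Qed.

Lemma Zp_unitV x : is_padic_unit p x -> is_padic_unit p x^-1.
Proof. by move=> /Zp_unitP[x0 zx vx]; apply/Zp_unitP; rewrite invr_eq0 invrK. Qed.

Lemma Zp_unit_int a : is_padic_unit p a%:~R <-> coprimez a p.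
Proof.
rewrite -padic_unit_intr; split=> [[z zu /eqP]|au]; last first.
  by exists a%:~R => //; rewrite rmorph_int.
by rewrite -(rmorph_int (@to_padic p)) => /eqP/to_padic_inj <-.
Qed.

Lemma padic_natr_neq0 n : (0 < n)%N -> n%:R != 0 :> padic p.
Proof. by move=> n0; rewrite pmulrn padic_intrF_eq0 eqz_nat -lt0n. Qed.

Lemma Zp_unit_sub x : is_padic_unit p x -> Zp x.
Proof. by case/Zp_unitP. Qed.

Lemma Zp_natV n : coprime n p -> Zp n%:R^-1.
Proof. by move=> np; rewrite pmulrn; apply/Zp_unit_sub/Zp_unitV/Zp_unit_int. Qed.

Lemma Zp_unit1 : is_padic_unit p 1.
Proof. by apply/(Zp_unit_int 1); rewrite coprimezE coprime1n. Qed.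

(** If p divided the denominator, reducing [z * denq r = numq r] modulo p would make it divide the
    numerator as well, against lowest terms. *)
Lemma qp_den r : Zp (qp r) -> coprimez (denq r) p.
Proof.
case=> z _ zr; rewrite coprimez_prime; apply/negP => pd.
have e : z * (denq r)%:~R = (numq r)%:~R.
  apply: to_padic_inj; rewrite rmorphM !rmorph_int /= zr.
  by rewrite /qp /ratr divfK // padic_intrF_eq0 denq_neq0.
have := congr1 (fun x : padic_int p => x 1%N) e.
rewrite residueM !residue_intr expn1 (dvdz_mod0P pd) mulr0 mod0z.
move=> /esym/dvdz_mod0P; move: pd; rewrite !dvdzE !absz_nat => pd pn.
have /eqP g1 := coprime_num_den r.
have : (prime_val p %| 1)%N by rewrite -g1 dvdn_gcd pn pd.
by rewrite Euclid_dvd1 //; exact: (valP p).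
Qed.

End PadicField.

(** The local-global bridge: a prime factor of the denominator contradicts integrality at that
    prime. *)
Lemma rat_int_of_padic (r : rat) : (forall p, is_padic_int p (qp p r)) ->
  r \is a Num.int.
Proof.
move=> h; suff d1 : denq r = 1.
  by rewrite -(divq_num_den r) d1 divr1 intr_int.
apply/eqP; rewrite -(gez0_abs (ltW (denq_gt0 r))) eqz_nat.
apply: contraT => d1; have := pdiv_prime (n := `|denq r|%N).
have -> : (1 < `|denq r|)%N by rewrite ltn_neqAle eq_sym d1 lt0n absz_eq0 denq_neq0.
move=> /(_ isT) pp; have := qp_den (h (exist (fun q : nat => prime q) _ pp)).
by rewrite coprimezE /= coprime_sym prime_coprime // pdiv_dvd.
Qed.

(** * Two by two matrices *)

Lemma ord2P (i : 'I_2) : i = 0 \/ i = 1.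
Proof. by case: i => [[|[|]]] // h; [left|right]; apply/val_inj. Qed.

Section TwoByTwo.
Variable K : comPzRingType.
Implicit Types (a b c d : K) (A B : 'M[K]_2).

Lemma mx2_eta A : A = mx2 (A 0 0) (A 0 1) (A 1 0) (A 1 1).
Proof.
apply/matrixP => i j; rewrite mxE.
by case: (ord2P i) => ->; case: (ord2P j) => ->.
Qed.

Lemma mx2_00 a b c d : mx2 a b c d 0 0 = a. Proof. by rewrite mxE. Qed.
Lemma mx2_01 a b c d : mx2 a b c d 0 1 = b. Proof. by rewrite mxE. Qed.
Lemma mx2_10 a b c d : mx2 a b c d 1 0 = c. Proof. by rewrite mxE. Qed.
Lemma mx2_11 a b c d : mx2 a b c d 1 1 = d. Proof. by rewrite mxE. Qed.
Definition mx2E := (mx2_00, mx2_01, mx2_10, mx2_11).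

Lemma mulmx2E A B i j : (A *m B) i j = A i 0 * B 0 j + A i 1 * B 1 j.
Proof. by rewrite mxE !big_ord_recl big_ord0 addr0; congr (_ + A _ _ * B _ _); apply/val_inj. Qed.

Lemma mx2_mul a b c d a' b' c' d' : mx2 a b c d *m mx2 a' b' c' d' =
  mx2 (a * a' + b * c') (a * b' + b * d') (c * a' + d * c') (c * b' + d * d').
Proof. by rewrite [LHS]mx2_eta !mulmx2E !mx2E. Qed.

Lemma mx2_1 : 1 = mx2 1 0 0 1 :> 'M[K]_2.
Proof. by rewrite [LHS]mx2_eta !mxE. Qed.

Lemma det2 A : \det A = A 0 0 * A 1 1 - A 0 1 * A 1 0.
Proof.
rewrite (expand_det_row _ 0) !big_ord_recl big_ord0 addr0 /cofactor !det_mx11 !mxE /=.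
by rewrite expr0 expr1 mul1r mulN1r mulrN; do ![congr (_ * _) || congr (_ - _) || congr (A _ _) || apply/val_inj].
Qed.

Lemma det_mx2 a b c d : \det (mx2 a b c d) = a * d - b * c.
Proof. by rewrite det2 !mx2E. Qed.

Definition adj2 A := mx2 (A 1 1) (- A 0 1) (- A 1 0) (A 0 0).

Lemma adj2_mul A : adj2 A *m A = mx2 (\det A) 0 0 (\det A).
Proof.
by rewrite {2}(mx2_eta A) mx2_mul det2; congr mx2; ring.
Qed.
End TwoByTwo.

Lemma map_mx2 (K L : Type) (h : K -> L) (a b c d : K) :
  map_mx h (mx2 a b c d) = mx2 (h a) (h b) (h c) (h d).
Proof.
by apply/matrixP => i j; rewrite !mxE; case: ifP => _; case: ifP.
Qed.

(** * The idelic lift of a Dirichlet character *)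

Section Characters.
Variables (R : realType) (N : nat) (hN : (0 < N)%N) (chi : dirichlet_char R N).
Implicit Types (q : nat) (j : int).

Lemma part_div q : prime q -> (q ^ logn q N * (N %/ q ^ logn q N) = N)%N.
Proof. by move=> qp; rewrite mulnC divnK // pfactor_dvdnn. Qed.

Lemma coprime_cofactor q : prime q -> coprime (N %/ q ^ logn q N) q.
Proof.
move=> qp; have [m mq e] := pfactor_coprime qp hN.
by rewrite {1}e mulnK ?expn_gt0 ?prime_gt0 // coprime_sym.
Qed.

Lemma part_coprime q : prime q -> coprimez (q ^ logn q N)%N%:Z (N %/ q ^ logn q N)%N%:Z.
Proof.
by move=> qp; rewrite coprimezE coprime_sym coprimeXr // coprime_cofactor.
Qed.

Lemma eq_modz_part q (x y : int) : prime q -> (x = y %[mod (q ^ logn q N)%N])%Z ->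
  (x = y %[mod (N %/ q ^ logn q N)%N])%Z -> (x = y %[mod N])%Z.
Proof.
move=> qp h1 h2; apply/eqP; move: (zchinese_remainder (part_coprime qp) x y).
by rewrite -PoszM part_div // => ->; rewrite h1 h2 !eqxx.
Qed.

(** Frees the proofs below from the representative picked by [zchinese]: any solution of the two
    congruences computes the factor. *)
Lemma dchar_part_spec q j x : prime q -> (x = j %[mod (q ^ logn q N)%N])%Z ->
  (x = 1 %[mod (N %/ q ^ logn q N)%N])%Z -> dchar_part chi q j = chi x.
Proof.
move=> qp h1 h2; apply: dchar_mod; apply: (@eq_modz_part q) => //.
  by rewrite zchinese_modl ?part_coprime.
by rewrite zchinese_modr ?part_coprime.
Qed.

Lemma dchar_part_exists q j : prime q -> exists2 x, (x = j %[mod (q ^ logn q N)%N])%Z &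
  (x = 1 %[mod (N %/ q ^ logn q N)%N])%Z.
Proof.
move=> qp; exists (zchinese (q ^ logn q N)%N%:Z (N %/ q ^ logn q N)%N%:Z j 1).
  by rewrite zchinese_modl ?part_coprime.
by rewrite zchinese_modr ?part_coprime.
Qed.

Lemma dchar_part_mod q j j' : prime q -> (j = j' %[mod (q ^ logn q N)%N])%Z ->
  dchar_part chi q j = dchar_part chi q j'.
Proof.
move=> qp h; have [x h1 h2] := dchar_part_exists j qp.
by rewrite (dchar_part_spec qp h1 h2) (@dchar_part_spec q j' x) // h1.
Qed.

Lemma dchar_partM q j j' : prime q ->
  dchar_part chi q (j * j') = dchar_part chi q j * dchar_part chi q j'.
Proof.
move=> qp; have [x h1 h2] := dchar_part_exists j qp.
have [y h3 h4] := dchar_part_exists j' qp.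
rewrite (dchar_part_spec qp h1 h2) (dchar_part_spec qp h3 h4).
rewrite (@dchar_part_spec q _ (x * y)) ?dcharM //.
  by rewrite -modzMm h1 h3 modzMm.
by rewrite -modzMm h2 h4 modzMm.
Qed.

Lemma dchar_part1 q : prime q -> dchar_part chi q 1 = 1.
Proof. by move=> qp; rewrite (@dchar_part_spec q 1 1) ?dchar1. Qed.

Lemma dchar_part_neq0 q j : prime q -> coprimez j q -> dchar_part chi q j != 0.
Proof.
move=> qp jq; have [x h1 h2] := dchar_part_exists j qp.
rewrite (dchar_part_spec qp h1 h2) dchar_neq0 -(part_div qp) PoszM coprimezMr.
apply/andP; split; rewrite /coprimez -gcdz_modl ?h1 ?h2 gcdz_modl.
  by rewrite -[_ == _]/(coprimez _ _) coprimezE /=; apply: coprimeXr.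
by rewrite gcd1z.
Qed.

Lemma eq_modz_primes (x y : int) :
  (forall q, prime q -> (q %| N)%N -> (x = y %[mod (q ^ logn q N)%N])%Z) ->
  (x = y %[mod N])%Z.
Proof.
move=> h; apply/modz_eq_dvd; rewrite dvdzE /=.
apply/dvdn_partP => // q; rewrite mem_primes => /and3P[qp _ qN].
by rewrite p_part; have /modz_eq_dvd := h q qp qN; rewrite dvdzE.
Qed.

Lemma part_dvd_compl q r : prime q -> prime r -> q != r ->
  (q ^ logn q N %| N %/ r ^ logn r N)%N.
Proof.
move=> qp rp qr; have := pfactor_dvdnn q N; rewrite -{2}(part_div rp) => h.
rewrite -(@Gauss_dvdr _ (r ^ logn r N)) //.
by rewrite coprimeXl // coprimeXr // prime_coprime // dvdn_prime2.
Qed.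

(** The product of the Chinese remainder lifts over a list [s] of primes is j modulo q^e for q in
    [s] and 1 modulo the other q^e; over all primes of N it is therefore congruent to j modulo N. *)
Lemma dchar_prod_parts j : \prod_(q <- primes N) dchar_part chi q j = chi j.
Proof.
have: exists2 x : seq nat -> int, forall s, {subset s <= primes N} ->
      \prod_(q <- s) dchar_part chi q j = chi (x s) &
    forall s, uniq s -> {subset s <= primes N} -> forall q, q \in primes N ->
      (x s = (if q \in s then j else 1) %[mod (q ^ logn q N)%N])%Z.
  pose x s := \prod_(q <- s) zchinese (q ^ logn q N)%N%:Z (N %/ q ^ logn q N)%N%:Z j 1.
  exists x => [s _|].
    rewrite /x; elim: s => [|q s IH]; first by rewrite !big_nil dchar1.
    by rewrite !big_cons dcharM IH.
  elim=> [|r s IH]; first by move=> _ _ q _; rewrite /x big_nil.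
  rewrite cons_uniq => /andP[rs us] sub q qN.
  have rp : prime r by have := sub r (mem_head _ _); rewrite mem_primes => /and3P[].
  have qp : prime q by move: qN; rewrite mem_primes => /and3P[].
  have sub' : {subset s <= primes N} by move=> u us'; apply: sub; rewrite in_cons us' orbT.
  rewrite /x big_cons -/(x s) -modzMmr (IH us sub' q qN) modzMmr in_cons.
  have [->|qr] := eqVneq q r.
    by rewrite (negbTE rs) mulr1 zchinese_modl ?part_coprime.
  rewrite -modzMml; suff -> : (zchinese (r ^ logn r N)%N%:Z (N %/ r ^ logn r N)%N%:Z j 1
      = 1 %[mod (q ^ logn q N)%N])%Z by rewrite modzMml mul1r.
  apply/modz_eq_dvd; apply: (@dvdz_trans (N %/ r ^ logn r N)%N).
    by rewrite dvdzE part_dvd_compl.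
  by apply/modz_eq_dvd; rewrite zchinese_modr ?part_coprime.
case=> x /(_ (primes N)) -> // h; apply: dchar_mod; apply: eq_modz_primes => q qp qN.
have qN' : q \in primes N by rewrite mem_primes qp hN.
by rewrite h ?primes_uniq // qN'.
Qed.

Lemma Zp_nonunit (p : prime_t) (x : padic p) : is_padic_int p x -> ~ is_padic_unit p x ->
  exists2 y, is_padic_int p y & x = p%:R * y.
Proof.
move=> [z _ <-] nu; have [y e] : exists y, z = (p ^ 1)%:R * y.
  apply: padic_dvd_exp; apply/eqP; rewrite -[_ == _]negbK -padic_unitE.
  by apply/negP => zu; apply: nu; exists z.
by exists (to_padic y); [exact: Zp_to|rewrite e rmorphM rmorph_nat].
Qed.

Lemma Zp_pmul_nonunit (p : prime_t) (y : padic p) : is_padic_int p y ->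
  ~ is_padic_unit p (p%:R * y).
Proof.
move=> [z _ <-] [w wu e].
have {}e : w = p%:R * z by apply: to_padic_inj; rewrite rmorphM rmorph_nat.
move: wu => /=; rewrite e unitrM pmulrn padic_unit_intr coprimezE /= /coprime gcdnn.
by case/andP => /eqP p1; have := valP p; rewrite /= -/(prime_val p) p1.
Qed.

Lemma Zp_unit_expz (p : prime_t) (m : int) : is_padic_unit p (p%:R ^ m) -> m = 0.
Proof.
have h n : ~ is_padic_unit p (p%:R ^+ n.+1).
  rewrite exprS; apply: Zp_pmul_nonunit; rewrite -natrX; exact: Zp_nat.
case: m => [[|n]|n]; first by [].
  by move=> /h.
by move=> /Zp_unitV; rewrite NegzE -exprnN invrK => /h.
Qed.

Lemma Zp_unit_shift (p : prime_t) (j : int) (e : nat) (z : padic_int p) : (0 < e)%N ->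
  is_padic_unit p (j%:~R + (p ^ e)%:R * to_padic z) <-> coprimez j p.
Proof.
move=> e0; have -> : j%:~R + (p ^ e)%:R * to_padic z = to_padic (j%:~R + (p ^ e)%:R * z).
  by rewrite rmorphD rmorphM rmorph_int rmorph_nat.
have uE : (j%:~R + (p ^ e)%:R * z \is a GRing.unit) = coprimez j p.
  rewrite -padic_unit_intr !padic_unitE; congr (_ != 0).
  have p1 : (p ^ 1 %| p ^ e)%N by rewrite dvdn_exp2l.
  rewrite pmulrn residueD residueM !residue_intr.
  rewrite (dvdz_mod0P (m := (p ^ e)%N%:Z) (d := (p ^ 1)%N%:Z) _) //.
  by rewrite mul0r mod0z addr0 modz_mod.
split=> [[w wu /to_padic_inj e']|]; first by rewrite -uE -e'.
by rewrite -uE => u; exists (j%:~R + (p ^ e)%:R * z).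
Qed.

Variable p : prime_t.
Hypothesis pN : (p %| N)%N.

Let pP : prime p := valP p.
Let e := logn p N.
Let e_gt0 : (0 < e)%N. Proof. by rewrite logn_gt0 mem_primes pP hN. Qed.

(** [chi_idelic] is a choice among the representations p^m (j + p^e z). On a unit m = 0, so the
    factors of the other primes disappear, and j is determined modulo p^e. *)
Lemma chi_idelicE (j : int) (x : padic p) : coprimez j p ->
  is_padic_int p ((x - j%:~R) / (p ^ e)%:R) -> chi_idelic chi x = (dchar_part chi p j)^-1.
Proof.
move=> jp [z _ hz].
have pe0 := @padic_natr_neq0 p _ (expp_gt0 p e).
have {}hz : x = j%:~R + (p ^ e)%:R * to_padic z by rewrite hz mulrC divfK // addrC subrK.
rewrite /chi_idelic; case: xgetP => [w ->|/(_ (dchar_part chi p j)^-1) []]; last first.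
  exists 0, j, z; split => //; first by rewrite expr0z mul1r.
  by rewrite big1 ?mulr1 // => q _; rewrite expr0z.
case=> m [j'] [z'] [jp' hx ->].
have xu : is_padic_unit p x by rewrite hz; apply/Zp_unit_shift.
have m0 : m = 0.
  apply: (@Zp_unit_expz p).
  have u' : is_padic_unit p (j'%:~R + (p ^ e)%:R * to_padic z') by apply/Zp_unit_shift.
  have [u0 _ _] := (Zp_unitP _).1 u'.
  have -> : p%:R ^ m = x * (j'%:~R + (p ^ e)%:R * to_padic z')^-1.
    by rewrite hx mulfK.
  by apply: Zp_unitM => //; exact: Zp_unitV.
rewrite m0 big1 ?mulr1 => [|q _]; last by rewrite expr0z.
rewrite (@dchar_part_mod p j' j) //.
move: hx; rewrite m0 expr0z mul1r hz.
have tE i (y : padic_int p) : i%:~R + (p ^ e)%:R * to_padic y = to_padic (i%:~R + (p ^ e)%:R * y).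
  by rewrite rmorphD rmorphM rmorph_int rmorph_nat.
rewrite !tE => /to_padic_inj /(congr1 (fun y : padic_int p => y e)).
rewrite pmulrn !residueD !residueM !residue_intr modzz !mul0r !mod0z !addr0 !modz_mod.
by move=> ->.
Qed.

Lemma Zp_unit_approx (x : padic p) : is_padic_unit p x ->
  exists2 j, coprimez j p & is_padic_int p ((x - j%:~R) / (p ^ e)%:R).
Proof.
move=> [z zu <-]; have [y hy] := padic_approx z e.
have pe0 := @padic_natr_neq0 p _ (expp_gt0 p e).
have tz : to_padic z = (z e)%:~R + (p ^ e)%:R * to_padic y.
  by rewrite [LHS](congr1 _ hy) rmorphD rmorphM rmorph_int rmorph_nat.
exists (z e); last first.
  by exists y => //; rewrite tz addrAC subrr add0r [_ * to_padic y]mulrC mulfK.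
apply/(@Zp_unit_shift p (z e) e y e_gt0).
by exists z.
Qed.

Lemma Zp_pow_N (x : padic p) : is_padic_int p (x / N%:R) -> is_padic_int p (x / (p ^ e)%:R).
Proof.
move=> h; have pe0 := @padic_natr_neq0 p _ (expp_gt0 p e).
have N0 : N%:R != 0 :> padic p by rewrite pmulrn padic_intrF_eq0 -lt0n.
have -> : x / (p ^ e)%:R = x / N%:R * (N %/ p ^ e)%:R.
  have eN : N%:R = (N %/ p ^ e)%:R * (p ^ e)%:R :> padic p.
    by rewrite -[in LHS](part_div pP) natrM mulrC.
  by apply: (mulIf pe0); rewrite (divfK pe0) -(mulrA (x / N%:R)) -eN (divfK N0).
exact: (ZpM h (Zp_nat p _)).
Qed.

(** The conductor of chi_p divides p^e, the p-part of N. *)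
Lemma chi_idelic_congr (x y : padic p) : is_padic_unit p y ->
  is_padic_int p ((x - y) / N%:R) -> chi_idelic chi x = chi_idelic chi y.
Proof.
move=> yu /Zp_pow_N h; have [j jp hj] := Zp_unit_approx yu.
rewrite (chi_idelicE jp hj) (@chi_idelicE j x jp) //.
have -> : (x - j%:~R) / (p ^ e)%:R = (x - y) / (p ^ e)%:R + (y - j%:~R) / (p ^ e)%:R.
  by rewrite -mulrDl addrA subrK.
exact: ZpD.
Qed.

Lemma chi_idelicM (x y : padic p) : is_padic_unit p x -> is_padic_unit p y ->
  chi_idelic chi (x * y) = chi_idelic chi x * chi_idelic chi y.
Proof.
move=> xu yu; have [j jp hj] := Zp_unit_approx xu; have [i ip hi] := Zp_unit_approx yu.
rewrite (chi_idelicE jp hj) (chi_idelicE ip hi) (@chi_idelicE (j * i)).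
- by rewrite dchar_partM // invfM.
- by rewrite coprimezMl jp.
have -> : (x * y - (j * i)%:~R) / (p ^ e)%:R =
    x * ((y - i%:~R) / (p ^ e)%:R) + i%:~R * ((x - j%:~R) / (p ^ e)%:R).
  by rewrite intrM; ring.
by apply: ZpD; apply: ZpM => //; [exact: Zp_unit_sub|exact: Zp_int].
Qed.

Lemma chi_idelic_int j : coprimez j p ->
  chi_idelic chi (j%:~R : padic p) = (dchar_part chi p j)^-1.
Proof. by move=> jp; rewrite (@chi_idelicE j) // subrr mul0r; exact: Zp0. Qed.

Lemma chi_idelic1 : chi_idelic chi (1 : padic p) = 1.
Proof. by rewrite (@chi_idelic_int 1) ?dchar_part1 ?invr1 // coprimezE coprime1n. Qed.

Lemma chi_idelic_neq0 (x : padic p) : is_padic_unit p x -> chi_idelic chi x != 0.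
Proof.
move=> xu; have [j jp hj] := Zp_unit_approx xu.
by rewrite (chi_idelicE jp hj) invr_eq0 dchar_part_neq0.
Qed.

End Characters.

(** * The group K_0(N) *)

Section Level.
Variables (N : nat) (hN : (0 < N)%N).

(* [K0] constrains the lower left entry only at p | N; elsewhere N is a unit, so the
   condition below is automatic. *)
Definition K0p (p : prime_t) (g : 'M[padic p]_2) : Prop :=
  [/\ is_padic_int p (g 0 0), is_padic_int p (g 0 1), is_padic_int p (g 1 0 / N%:R),
      is_padic_int p (g 1 1) & is_padic_unit p (\det g)].

Lemma Zp_divN p (x : padic p) : is_padic_int p (x / N%:R) -> is_padic_int p x.
Proof.
by move=> h; rewrite -(divfK (@padic_natr_neq0 p _ hN) x); apply: (ZpM h (Zp_nat _ _)).
Qed.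

Lemma K0E (kap : forall p, 'M[padic p]_2) : K0 N kap <-> forall p, K0p (kap p).
Proof.
split=> [h p|h p]; last first.
  have [h0 h1 h2 h3 h4] := h p; split; last first.
    by case: h2 => z _ e _; exists z; rewrite e mulrC (divfK (@padic_natr_neq0 p _ hN)).
  split=> // i j.
  case: (ord2P i) => ->; case: (ord2P j) => ->.
  - exact: h0.
  - exact: h1.
  - exact: Zp_divN h2.
  - exact: h3.
have [[h1 h2] h3] := h p; split=> //.
have [/h3[z ->]|pN] := boolP (p %| N)%N.
  by rewrite mulrAC (divff (@padic_natr_neq0 p _ hN)) mul1r; apply: Zp_to.
by apply: ZpM => //; apply: Zp_natV; rewrite coprime_sym prime_coprime ?(valP p).
Qed.

Lemma K0pM p (g h : 'M[padic p]_2) : K0p g -> K0p h -> K0p (g *m h).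
Proof.
move=> [g0 g1 g2 g3 g4] [h0 h1 h2 h3 h4]; split; rewrite ?mulmx2E.
- by apply: ZpD; apply: ZpM => //; apply: Zp_divN.
- by apply: ZpD; apply: ZpM.
- rewrite mulrDl [X in X + _]mulrAC -[X in _ + X]mulrA.
  exact: (ZpD (ZpM g2 h0) (ZpM g3 h2)).
- by apply: ZpD; apply: ZpM => //; apply: Zp_divN.
- by rewrite det_mulmx; apply: Zp_unitM.
Qed.

(** The adjugate formula, so that membership in K_0(N) can be checked entry by entry. *)
Definition inv2 (K : fieldType) (g : 'M[K]_2) : 'M[K]_2 :=
  mx2 (g 1 1 / \det g) (- g 0 1 / \det g) (- g 1 0 / \det g) (g 0 0 / \det g).

Lemma mul_inv2 (K : fieldType) (g : 'M[K]_2) : \det g != 0 -> g *m inv2 g = 1.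
Proof.
move=> d0; rewrite {1}(mx2_eta g) mx2_mul mx2_1.
have dE := det2 g; move: d0 dE; set d := \det g => d0 dE.
by congr mx2; rewrite !mulrA -!mulrDl ?mulrN ?mulNr ?(mulrC (g 0 1) (g 0 0))
  ?(mulrC (g 1 1) (g 1 0)) ?subrr ?addNr ?mul0r // -?dE ?divff // addrC
  (mulrC (g 1 1)) (mulrC (g 1 0)) -dE divff.
Qed.

Lemma K0p_inv p (g : 'M[padic p]_2) : K0p g -> K0p (inv2 g).
Proof.
move=> [g0 g1 g2 g3 /[dup] g4 /Zp_unitP[d0 _ dV]]; split; rewrite ?mx2E.
- exact: ZpM.
- exact: (ZpM (ZpN g1)).
- by rewrite mulrAC mulNr; apply: (ZpM (ZpN g2)).
- exact: ZpM.
have <- : (\det g)^-1 = \det (inv2 g); last exact: Zp_unitV.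
apply: (mulfI d0); rewrite -det_mulmx (mul_inv2 d0) det1.
exact: (divff d0).
Qed.

Lemma K0p_quotient p (a g h : 'M[padic p]_2) : K0p g -> K0p h -> a *m g = h -> K0p a.
Proof.
move=> gK hK e; have /Zp_unitP[d0 _ _] : is_padic_unit p (\det g) by case: gK.
have <- : h *m inv2 g = a.
  by rewrite -e -mulmxA (mul_inv2 d0); exact: mulmx1.
by apply: K0pM => //; apply: K0p_inv.
Qed.

(** If p divided d, it would divide ad - bc too, since c is a multiple of N and hence of p. *)
Lemma K0p_11_unit p (g : 'M[padic p]_2) : (p %| N)%N -> K0p g -> is_padic_unit p (g 1 1).
Proof.
move=> pN [g0 g1 g2 g3 g4]; apply: contrapT => nu.
have [y hy e] := Zp_nonunit g3 nu.
have [c Nc] : exists c, N = (p * c)%N by case/dvdnP: pN => c ->; exists c; rewrite mulnC.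
have := g4; rewrite det2 e -(divfK (@padic_natr_neq0 p _ hN) (g 1 0)) {2}Nc natrM.
have -> : g 0 0 * (p%:R * y) - g 0 1 * (g 1 0 / N%:R * (p%:R * c%:R)) =
   p%:R * (g 0 0 * y - g 0 1 * (g 1 0 / N%:R) * c%:R) by ring.
apply: Zp_pmul_nonunit; apply: ZpB; first exact: ZpM.
by apply: ZpM; [apply: ZpM|exact: Zp_nat].
Qed.

Lemma val_primes_of : map prime_val (primes_of N) = primes N.
Proof.
rewrite (pmap_filter (insubK _)); apply/all_filterP/allP => q.
by rewrite mem_primes => /and3P[qp _ _] /=; rewrite isSome_insub.
Qed.

Lemma mem_primes_of (p : prime_t) : p \in primes_of N -> (p %| N)%N.
Proof.
move=> h; have : prime_val p \in primes N by rewrite -val_primes_of; apply: map_f.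
by rewrite mem_primes => /and3P[].
Qed.

Lemma uniq_primes_of : uniq (primes_of N).
Proof. by apply: pmap_sub_uniq; apply: primes_uniq. Qed.

Lemma primes_ofP (p : prime_t) : (p %| N)%N -> p \in primes_of N.
Proof.
by move=> pN; rewrite mem_pmap_sub mem_primes hN (valP p).
Qed.

Section Chi.
Variables (R : realType) (chi : dirichlet_char R N).

(** The lower right entry of the product differs from the product of the lower right entries by a
    multiple of the lower left entry of [g], which is divisible by N. *)
Lemma chi_K0M (g h : forall p, 'M[padic p]_2) : (forall p, K0p (g p)) ->
  (forall p, K0p (h p)) ->
  chi_K0 chi (fun p => g p *m h p) = chi_K0 chi g * chi_K0 chi h.
Proof.
move=> gK hK; rewrite /chi_K0 -big_split /=; apply: eq_big_seq => p /mem_primes_of pN.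
have gu := K0p_11_unit pN (gK p); have hu := K0p_11_unit pN (hK p).
rewrite -(chi_idelicM hN chi pN gu hu); apply: (chi_idelic_congr hN) => //.
  exact: Zp_unitM.
rewrite mulmx2E addrK mulrAC.
by have [_ _ g10 _ _] := gK p; have [_ h01 _ _ _] := hK p; apply: ZpM.
Qed.

(** The inverse comes from the component of the idelic lift at p | N; together these components
    rebuild chi. *)
Lemma chi_K0_int (d : 'M[int]_2) : coprimez (d 1 1) N ->
  chi_K0 chi (fun p => map_mx intr d) = (chi (d 1 1))^-1.
Proof.
move=> dN; rewrite -(dchar_prod_parts hN chi) -val_primes_of big_map.
rewrite -prodfV; apply: eq_big_seq => p /mem_primes_of pN; rewrite mxE.
apply: (chi_idelic_int hN chi pN); move: dN; rewrite !coprimezE /= => dN.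
exact: coprime_dvdr pN dN.
Qed.

End Chi.
End Level.

(** * Slash operators and the adelic lift *)

Section Slash.
Variable R : realType.
Implicit Types (g h : 'M[R]_2) (f : R[i] -> R[i]) (z : R[i]) (x y : R) (k : int).

Definition mobius g z := ((g 0 0)%:C * z + (g 0 1)%:C) / ((g 1 0)%:C * z + (g 1 1)%:C).

Lemma Im_mobius g z : 0 < \det g -> 0 < complex.Im z ->
  (g 1 0)%:C * z + (g 1 1)%:C != 0 /\ 0 < complex.Im (mobius g z).
Proof.
move=> d0; case: z => x y; rewrite [complex.Im (x +i* y)]/= => y0.
(* This is |cz + d|^2. *)
set n := (g 1 0 * x + g 1 1) ^+ 2 + (g 1 0 * y) ^+ 2.
have n0 : 0 < n.
  rewrite lt_neqAle addr_ge0 ?sqr_ge0 // andbT eq_sym paddr_eq0 ?sqr_ge0 //.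
  rewrite !sqrf_eq0 mulf_eq0 (gt_eqF y0) orbF; apply/negP => /andP[/eqP h /eqP c0].
  move: d0; rewrite det2; move: h; rewrite c0 mul0r add0r => ->.
  by rewrite !mulr0 subrr ltxx.
have jE : (g 1 0)%:C * (x +i* y) + (g 1 1)%:C = (g 1 0 * x + g 1 1) +i* (g 1 0 * y).
  by apply/eqP; rewrite eq_complex /=; apply/andP; split; apply/eqP; ring.
split.
  rewrite jE eq_complex /=; apply/negP => /andP[/eqP a0 /eqP b0].
  by move: n0; rewrite /n a0 b0 !expr0n /= addr0 ltxx.
rewrite /mobius jE.
suff -> : complex.Im (((g 0 0)%:C * (x +i* y) + (g 0 1)%:C) / ((g 1 0 * x + g 1 1) +i* (g 1 0 * y)))
  = \det g * y / n by rewrite divr_gt0 ?mulr_gt0.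
by rewrite det2 /= -!/n; field; rewrite gt_eqF.
Qed.

(** The factor j(g, z) = cz + d is a cocycle: j(gh, z) = j(g, hz) j(h, z). *)
Lemma slash_mul k g h f z : (h 1 0)%:C * z + (h 1 1)%:C != 0 ->
  slash k (g *m h) f z = slash k h (slash k g f) z.
Proof.
move=> j0; rewrite /slash; set jh := _ * z + (h 1 1)%:C in j0 *.
rewrite -/(mobius h z); set w := mobius h z.
have hw : w * jh = (h 0 0)%:C * z + (h 0 1)%:C by rewrite divfK.
have lin a b : (a * h 0 0 + b * h 1 0)%:C * z + (a * h 0 1 + b * h 1 1)%:C
    = (a%:C * w + b%:C) * jh.
  by rewrite mulrDl -mulrA hw /jh !rmorphD !rmorphM /=; ring.
rewrite !mulmx2E !lin -mulf_div (divff j0) mulr1 mulrA; congr (_ * _).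
by rewrite normrM -mulf_div expfzMl mulrC.
Qed.

(** [adelic_lift] only evaluates at i; the affine matrix carries i to x + iy with automorphy factor
    1. *)
Lemma slash_affine k g f x y : slash k (g *m mx2 y x 0 1) f 'i = slash k g f (x +i* y).
Proof.
rewrite /slash !mulmx2E !mx2E !mulr0 !mulr1 !addr0.
have lin a b : (a * y)%:C * 'i + (a * x + b)%:C = a%:C * (x +i* y) + b%:C :> R[i].
  by apply/eqP; rewrite eq_complex /=; apply/andP; split; apply/eqP; ring.
by rewrite !lin.
Qed.

Lemma slash_scale k g f (c : R) z : 0 < c -> slash k (g *m mx2 c 0 0 c) f z = slash k g f z.
Proof.
move=> c0; have c0' : c%:C != 0 :> R[i] by rewrite eq_complex /= gt_eqF.
rewrite /slash !mulmx2E !mx2E !mulr0 !addr0 !add0r.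
have lin a b : (a * c)%:C * z + (b * c)%:C = c%:C * (a%:C * z + b%:C) :> R[i].
  by rewrite !rmorphM /=; ring.
rewrite !lin normrM -!mulf_div (divff c0') mul1r.
by rewrite ger0_norm ?divff ?mul1r // ler0c ltW.
Qed.

Variables (N : nat) (hN : (0 < N)%N) (chi : dirichlet_char R N) (k : int) (f : R[i] -> R[i]).
Hypothesis hf : forall gam z, Gamma0 N gam -> 0 < complex.Im z ->
    slash k (int_mx R gam) f z = chi (gam 1 1) * f z.

Lemma slash_Gamma0 gam g : Gamma0 N gam -> 0 < \det g ->
  slash k (int_mx R gam *m g) f 'i = chi (gam 1 1) * slash k g f 'i.
Proof.
move=> gN d0; have [j0 im] := Im_mobius (z := 'i) d0 ltr01.
rewrite slash_mul // [LHS]/slash -/(mobius g 'i) hf //.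
by rewrite [in RHS]/slash mulrCA.
Qed.

(** The determinant and its inverse are integral at every prime, so both are integers, and
    positivity leaves 1; the entries are integers by the same local-global argument. *)
Lemma rat_mx_Gamma0 (d : 'M[rat]_2) : 0 < \det d -> (forall p, K0p N (map_mx (qp p) d)) ->
  exists2 m : 'M[int]_2, Gamma0 N m & d = map_mx intr m.
Proof.
move=> d0 hd; have N0 : (N%:R : rat) != 0 by rewrite pnatr_eq0 -lt0n.
have /intrP[a ha] : d 0 0 \is a Num.int.
  by apply: rat_int_of_padic => p; have [] := hd p; rewrite !mxE.
have /intrP[b hb] : d 0 1 \is a Num.int.
  by apply: rat_int_of_padic => p; have [] := hd p; rewrite !mxE.
have /intrP[c hc] : d 1 0 / N%:R \is a Num.int.
  apply: rat_int_of_padic => p; have [] := hd p; rewrite !mxE => _ _.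
  by rewrite fmorph_div rmorph_nat.
have /intrP[e he] : d 1 1 \is a Num.int.
  by apply: rat_int_of_padic => p; have [] := hd p; rewrite !mxE.
have hu p : is_padic_unit p (qp p (\det d)).
  by have [_ _ _ _] := hd p; rewrite det_map_mx.
have /intrP[u hu1] : \det d \is a Num.int.
  by apply: rat_int_of_padic => p; apply: Zp_unit_sub.
have /intrP[v hv1] : (\det d)^-1 \is a Num.int.
  by apply: rat_int_of_padic => p; rewrite fmorphV; apply: Zp_unit_sub; apply: Zp_unitV.
have uv : u * v = 1.
  by apply: (@intr_inj rat); rewrite intrM -hu1 -hv1 divff // gt_eqF.
have u1 : u = 1.
  have : 0 < u by rewrite -(ltr0z rat) -hu1.
  have : (u %| 1)%Z by apply/dvdzP; exists v; rewrite mulrC uv.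
  by rewrite dvdz1 => /eqP; lia.
have {}hc : d 1 0 = (c * N)%:~R by rewrite intrM -hc divfK.
have dE : d = map_mx intr (mx2 a b (c * N) e).
  by rewrite map_mx2 (mx2_eta d) ha hb hc he.
exists (mx2 a b (c * N) e) => //; rewrite /Gamma0 mx2E dvdz_mull ?dvdzz // andbT.
by apply/eqP/(@intr_inj rat); rewrite -det_map_mx -dE hu1 u1.
Qed.

(* Two decompositions of the same adelic matrix differ by an element of Gamma0(N) with
   lower right entry d, which contributes chi d through f and its inverse through chi_K0. *)
Lemma adelic_liftE (gam : 'M[rat]_2) (g : 'M[R]_2) kap :
  \det gam != 0 -> 0 < \det g -> (forall p, K0p N (kap p)) ->
  adelic_lift chi k f (adelic_mul (adelic_mul (i_diag R gam) (i_inf g)) (i_fin R kap))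
  = slash k g f 'i * chi_K0 chi kap.
Proof.
move=> gam0 g0 kapK; rewrite /adelic_lift.
case: xgetP => [w ->|/(_ (slash k g f 'i * chi_K0 chi kap)) []]; last first.
  by exists gam, g, kap; split=> //; apply/(K0E hN).
case=> gam' [g'] [kap'] [gam'0 g'0 /(K0E hN) kapK' e ->].
have einf : map_mx ratr gam *m g = map_mx ratr gam' *m g' :> 'M[R]_2.
  by have := congr1 (@mx_inf R) e; rewrite /= !mulmx1.
have efin p : map_mx (qp p) gam *m kap p = map_mx (qp p) gam' *m kap' p.
  by have := congr1 (fun h : adelic_mx R => mx_fin h p) e; rewrite /= !mulmx1.
have gamU : gam \in unitmx by rewrite unitmxE unitfE.
have [d dE] : exists d, gam' = gam *m d by exists (invmx gam *m gam'); rewrite mulKVmx.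
have dinf : map_mx ratr d *m g' = g.
  have U : map_mx ratr gam \in @unitmx R 2 by rewrite map_unitmx.
  by rewrite -[RHS](mulKmx U) einf dE map_mxM -mulmxA (mulKmx U).
have dfin p : map_mx (qp p) d *m kap' p = kap p.
  have U : map_mx (qp p) gam \in unitmx by rewrite map_unitmx.
  by rewrite -[RHS](mulKmx U) efin dE map_mxM -mulmxA (mulKmx U).
have d0 : 0 < \det d.
  by move: g0; rewrite -dinf det_mulmx det_map_mx pmulr_lgt0 // ltr0q.
have dK p : K0p N (map_mx (qp p) d) by apply: (K0p_quotient hN (kapK' p) (kapK p)).
have [m mN mE] := rat_mx_Gamma0 d0 dK.
have mp p : map_mx (qp p) d = map_mx intr m.
  by rewrite mE; apply/matrixP => i j; rewrite !mxE qp_int.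
have minf : map_mx ratr d = int_mx R m.
  by rewrite mE; apply/matrixP => i j; rewrite !mxE ratr_int.
have mcop : coprimez (m 1 1) N.
  case/andP: mN => /eqP m1 /dvdzP[c m10]; apply/coprimezP.
  exists (m 0 0, - (m 0 1 * c)) => /=; rewrite -m1 det2 m10; ring.
rewrite -dinf minf slash_Gamma0 //.
have -> : chi_K0 chi kap = chi_K0 chi (fun p => map_mx (qp p) d *m kap' p).
  by congr (chi_K0 chi _); apply: functional_extensionality_dep => p; rewrite dfin.
rewrite (chi_K0M hN chi dK kapK').
have -> : chi_K0 chi (fun p => map_mx (qp p) d) = (chi (m 1 1))^-1.
  rewrite -(chi_K0_int hN chi mcop); congr (chi_K0 chi _).
  by apply: functional_extensionality_dep => p; rewrite mp.
have c0 : chi (m 1 1) != 0 by rewrite dchar_neq0.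
by field.
Qed.

End Slash.

(** * Complex limits, exponentials and integrals *)

Section ComplexLimits.
Variable R : realType.
Implicit Types (z w : R[i]) (T : Type).

Lemma cReD z w : complex.Re (z + w) = complex.Re z + complex.Re w.
Proof. by case: z; case: w. Qed.

Lemma cImD z w : complex.Im (z + w) = complex.Im z + complex.Im w.
Proof. by case: z; case: w. Qed.

Lemma normc_ge_Im z : `|complex.Im z|%:C <= `|z|.
Proof.
have := normc_ge_Re (- 'i * z); rewrite normrM.
have -> : `|- 'i : R[i]| = 1 by rewrite normrN normc_def /= expr0n expr1n add0r sqrtr1.
by rewrite mul1r; congr (_ <= _); congr (`|_|%:C); case: z => a b /=; ring.
Qed.

Lemma normc_le z : `|z| <= (`|complex.Re z| + `|complex.Im z|)%:C.
Proof.
case: z => a b; have -> : a +i* b = a%:C + 'i * b%:C.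
  exact: (complexE (a +i* b)).
apply: le_trans (ler_normD _ _) _; rewrite rmorphD /= normrM.
have -> : `|'i : R[i]| = 1 by rewrite normc_def /= expr0n expr1n add0r sqrtr1.
rewrite mul1r; have nR (r : R) : `|r%:C| = `|r|%:C :> R[i].
  by rewrite normc_def /= expr0n addr0 sqrtr_sqr.
have -> : a + (0 * b - 1 * 0) = a by ring.
have -> : 0 + (0 * 0 + 1 * b) = b by ring.
by rewrite !nR.
Qed.

Lemma CcvgP T (F : set_system T) (FF : Filter F) (u : T -> R[i]) (l : R[i]) :
  Ccvg F u l <-> (complex.Re (u t) @[t --> F] --> complex.Re l /\
                  complex.Im (u t) @[t --> F] --> complex.Im l).
Proof.
split=> [/cvgrPdist_lt h|[/cvgrPdist_lt hr /cvgrPdist_lt hi]].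
  split; apply/cvgrPdist_lt => e e0.
    have e0' : (0 : R[i]) < e%:C by rewrite ltcR.
    apply: filterS (h _ e0') => t; rewrite -ltcR; apply: le_lt_trans.
    by apply: le_trans (normc_ge_Re _); rewrite raddfB.
  have e0' : (0 : R[i]) < e%:C by rewrite ltcR.
  apply: filterS (h _ e0') => t; rewrite -ltcR; apply: le_lt_trans.
  by apply: le_trans (normc_ge_Im _); rewrite raddfB.
apply/cvgrPdist_lt => -[e e']; rewrite ltcE /= => /andP[/eqP -> e0].
have e20 : 0 < e / 2 by rewrite divr_gt0.
apply: filterS2 (hr _ e20) (hi _ e20) => t h1 h2.
apply: le_lt_trans (normc_le _) _; rewrite -[X in _ < X]/(e%:C) ltcR.
by rewrite (splitr e) !raddfB /= ltrD.
Qed.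

Lemma Ccvg_dist T (F : set_system T) (FF : Filter F) (u : T -> R[i]) (l e : R[i]) :
  Ccvg F u l -> 0 < e -> \forall t \near F, `|l - u t| < e.
Proof. by move=> /cvgrPdist_lt h e0; apply: h. Qed.

Lemma Ccvg_unique T (F : set_system T) (FF : ProperFilter F) (u : T -> R[i]) (l l' : R[i]) :
  Ccvg F u l -> Ccvg F u l' -> l = l'.
Proof.
move=> /CcvgP[r i] /CcvgP[r' i']; apply/eqP; rewrite eq_complex; apply/andP; split; apply/eqP.
  exact: (cvg_unique _ r r').
exact: (cvg_unique _ i i').
Qed.

Lemma CcvgM T (F : set_system T) (FF : Filter F) (u v : T -> R[i]) (l l' : R[i]) :
  Ccvg F u l -> Ccvg F v l' -> Ccvg F (fun t => u t * v t) (l * l').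
Proof. exact: cvgM. Qed.

Lemma Ccvg_sum (I : Type) (s : seq I) T (F : set_system T) (FF : Filter F)
  (u : I -> T -> R[i]) (l : I -> R[i]) :
  (forall i, Ccvg F (u i) (l i)) ->
  Ccvg F (fun t => \sum_(i <- s) u i t) (\sum_(i <- s) l i).
Proof.
move=> h; elim: s => [|i s IH].
  by rewrite big_nil; under eq_fun do rewrite big_nil; exact: cvg_cst.
by rewrite big_cons; under eq_fun do rewrite big_cons; exact: (cvgD (h i) IH).
Qed.

Lemma Ccvg_near_cst T (F : set_system T) (FF : Filter F) (u : T -> R[i]) (l : R[i]) :
  (\forall t \near F, u t = l) -> Ccvg F u l.
Proof. by move=> h; apply: cvg_near_cst. Qed.
End ComplexLimits.

Section E2pi.
Variable R : realType.
Implicit Types (x y : R).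

Lemma e2piD x y : e2pi (x + y) = e2pi x * e2pi y.
Proof.
rewrite /e2pi mulrDr cosD sinD; apply/eqP; rewrite eq_complex /=.
by apply/andP; split; apply/eqP; ring.
Qed.

Lemma e2pi0 : e2pi (0 : R) = 1.
Proof. by rewrite /e2pi mulr0 cos0 sin0. Qed.

Lemma norm_e2pi x : `|e2pi x| = 1.
Proof. by rewrite normc_def /= cos2Dsin2 sqrtr1. Qed.

Lemma e2pi_neq0 x : e2pi x != 0.
Proof. by rewrite -normr_eq0 norm_e2pi oner_eq0. Qed.

Lemma e2piN x : e2pi (- x) = (e2pi x)^-1.
Proof.
by apply: (mulfI (e2pi_neq0 x)); rewrite -e2piD subrr e2pi0 divff ?e2pi_neq0.
Qed.

Lemma e2piMn x n : e2pi (x *+ n) = e2pi x ^+ n.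
Proof. by elim: n => [|n IH]; rewrite ?e2pi0 // mulrS e2piD IH exprS. Qed.

Lemma e2pi1 : e2pi (1 : R) = 1.
Proof. by rewrite /e2pi mulr1 mulr_natl cos2pi sin2pi. Qed.

Lemma e2pi_int x : x \is a Num.int -> e2pi x = 1.
Proof.
case/intrP => -[n|n] ->.
  by rewrite -pmulrn e2piMn e2pi1 expr1n.
by rewrite NegzE mulrNz e2piN -pmulrn e2piMn e2pi1 expr1n invr1.
Qed.

(** Half-angle formula: for the fractional part r of x, cos(2 pi r) = 1 forces sin(pi r) = 0, which
    is impossible for 0 < r < 1. *)
Lemma e2pi_eq1 x : e2pi x = 1 -> x \is a Num.int.
Proof.
move=> h; pose r := x - (Num.floor x)%:~R.
have er : e2pi r = 1 by rewrite e2piD e2piN h (e2pi_int (intr_int R _)) invr1 mulr1.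
have /andP[r0 r1] : 0 <= r < 1 by rewrite subr_ge0 floor_le ltrBlDl -[_ + 1]intrD1 floorD1_gt.
suff r00 : r = 0.
  by move/eqP: r00; rewrite subr_eq0 => /eqP ->; rewrite intr_int.
apply: contrapT => /eqP rn0; have rp : 0 < r by rewrite lt_neqAle eq_sym rn0.
have : sin (pi * r) != 0.
  by rewrite gt_eqF // sin_gt0_pi // mulr_gt0 ?pi_gt0 //= gtr_pMr ?pi_gt0.
move: er => /(congr1 (@complex.Re R)) /=.
have -> : 2 * pi * r = (pi * r) *+ 2 by rewrite -mulr_natl; ring.
rewrite cos_mulr2n cos2sin2 => h2 /eqP; apply; apply/eqP; rewrite -sqrf_eq0.
by apply/eqP; move: h2; lra.
Qed.
End E2pi.

Section CIntegral.
Context d (T : measurableType d) (R : realType).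
Variables (mu : {measure set T -> \bar R}) (D : set T) (mD : measurable D).
Implicit Types (h : T -> R[i]) (c : R[i]).

Definition Cintegrable h :=
  mu.-integrable D (fun x => (complex.Re (h x))%:E) /\
  mu.-integrable D (fun x => (complex.Im (h x))%:E).

Definition Cmeasurable h :=
  measurable_fun D (fun x => complex.Re (h x)) /\
  measurable_fun D (fun x => complex.Im (h x)).

Lemma eq_Cintegral h h' : (forall x, D x -> h x = h' x) ->
  Cintegral mu D h = Cintegral mu D h'.
Proof.
move=> e; rewrite /Cintegral; congr Complex; apply: eq_Rintegral => x /set_mem Dx;
  by rewrite e.
Qed.

Lemma Cintegrable_Rscale (a b : R) (u v : T -> R) : mu.-integrable D (EFin \o u) ->
  mu.-integrable D (EFin \o v) ->
  mu.-integrable D (EFin \o (fun x => a * u x + b * v x)) /\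
  \int[mu]_(x in D) (a * u x + b * v x) =
    a * (\int[mu]_(x in D) u x) + b * (\int[mu]_(x in D) v x).
Proof.
move=> iu iv.
have iau : mu.-integrable D (EFin \o (fun x => a * u x)).
  by apply: eq_integrable (integrableZl mD a iu) => // x _ /=; rewrite EFinM.
have ibv : mu.-integrable D (EFin \o (fun x => b * v x)).
  by apply: eq_integrable (integrableZl mD b iv) => // x _ /=; rewrite EFinM.
split; last by rewrite RintegralD // !RintegralZl.
by apply: eq_integrable (integrableD mD iau ibv) => // x _ /=; rewrite EFinD.
Qed.

Lemma CintegralD h h' : Cintegrable h -> Cintegrable h' ->
  Cintegrable (fun x => h x + h' x) /\
  Cintegral mu D (fun x => h x + h' x) = Cintegral mu D h + Cintegral mu D h'.
Proof.
move=> [hr hi] [hr' hi'].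
have [r1 r2] := Cintegrable_Rscale 1 1 hr hr'.
have [i1 i2] := Cintegrable_Rscale 1 1 hi hi'.
split.
  split; first by apply: eq_integrable r1 => // x _ /=; rewrite !mul1r cReD.
  by apply: eq_integrable i1 => // x _ /=; rewrite !mul1r cImD.
apply/eqP; rewrite eq_complex /=; apply/andP; split; apply/eqP.
  have e0 (a b : R) : a + b = 1 * a + 1 * b by rewrite !mul1r.
  by rewrite e0 -r2; apply: eq_Rintegral => x _; rewrite !mul1r cReD.
have e0 (a b : R) : a + b = 1 * a + 1 * b by rewrite !mul1r.
by rewrite e0 -i2; apply: eq_Rintegral => x _; rewrite !mul1r cImD.
Qed.

Lemma CintegralZ c h : Cintegrable h ->
  Cintegrable (fun x => c * h x) /\
  Cintegral mu D (fun x => c * h x) = c * Cintegral mu D h.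
Proof.
case: c => a b [hr hi].
have reE x : complex.Re ((a +i* b) * h x) = a * complex.Re (h x) + (- b) * complex.Im (h x).
  by case: (h x) => s t /=; ring.
have imE x : complex.Im ((a +i* b) * h x) = b * complex.Re (h x) + a * complex.Im (h x).
  by case: (h x) => s t /=; ring.
have [r1 r2] := Cintegrable_Rscale a (- b) hr hi.
have [i1 i2] := Cintegrable_Rscale b a hr hi.
split.
  by split; [apply: eq_integrable r1|apply: eq_integrable i1] => // x _ /=; rewrite ?reE ?imE.
rewrite /Cintegral; under eq_Rintegral do rewrite reE.
under [X in _ +i* X]eq_Rintegral do rewrite imE.
rewrite r2 i2; apply/eqP; rewrite eq_complex /=; apply/andP; split; apply/eqP; ring.
Qed.

Lemma Cintegrable0 : Cintegrable (fun=> 0) /\ Cintegral mu D (fun=> 0) = 0.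
Proof.
split; first by split; exact: integrable0.
by rewrite /Cintegral /Rintegral /= integral0.
Qed.

Lemma Cintegral_sum (I : Type) (s : seq I) (h : I -> T -> R[i]) :
  (forall i, Cintegrable (h i)) ->
  Cintegrable (fun x => \sum_(i <- s) h i x) /\
  Cintegral mu D (fun x => \sum_(i <- s) h i x) = \sum_(i <- s) Cintegral mu D (h i).
Proof.
move=> hI; elim: s => [|i s [IH1 IH2]].
  by rewrite big_nil; under eq_fun do rewrite big_nil; exact: Cintegrable0.
rewrite big_cons; under eq_fun do rewrite big_cons.
by rewrite -IH2; apply: CintegralD.
Qed.

Hypothesis muD : (mu D < +oo)%E.

Lemma integrable_cst_fin (S : R) : mu.-integrable D (EFin \o (cst S)).
Proof.
apply/integrableP; split; first by apply/measurable_EFinP; exact: measurable_cst.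
by rewrite /= integral_cst //; apply: lte_mul_pinfty.
Qed.

Lemma Cintegrable_bounded h (S : R) : Cmeasurable h ->
  (forall x, D x -> `|h x| <= S%:C) -> Cintegrable h.
Proof.
move=> [mr mi] hS; have iS : mu.-integrable D (EFin \o (cst S)).
  exact: integrable_cst_fin.
split.
  apply: le_integrable iS => //; first exact/measurable_EFinP.
  move=> x Dx /=; rewrite lee_fin; apply: le_trans (ler_norm _).
  by rewrite -lecR; apply: le_trans (normc_ge_Re _) (hS _ Dx).
apply: le_integrable iS => //; first exact/measurable_EFinP.
move=> x Dx /=; rewrite lee_fin; apply: le_trans (ler_norm _).
by rewrite -lecR; apply: le_trans (normc_ge_Im _) (hS _ Dx).
Qed.

Lemma Rintegral_dominated (u_ : nat -> T -> R) (u : T -> R) (S : R) :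
  (forall n, measurable_fun D (u_ n)) ->
  (forall x, D x -> u_ n x @[n --> \oo] --> u x) ->
  (forall n x, D x -> `|u_ n x| <= S) ->
  \int[mu]_(x in D) u_ n x @[n --> \oo] --> \int[mu]_(x in D) u x.
Proof.
move=> mu_ cu bu; have iS : mu.-integrable D (EFin \o (cst S)).
  exact: integrable_cst_fin.
have mue n : measurable_fun D (EFin \o u_ n) by exact/measurable_EFinP.
have cue x : D x -> (EFin \o u_ n) x @[n --> \oo] --> (EFin \o u) x.
  by move=> Dx; apply: cvg_EFin; [exact: nearW|exact: cu].
have bue n x : D x -> (`|(EFin \o u_ n) x| <= (EFin \o cst S) x)%E.
  by move=> Dx; rewrite /= lee_fin bu.
have fing x : D x -> (EFin \o cst S) x \is a fin_num by [].
have cv := dominated_cvg mD mue cue fing iS bue.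
apply: fine_cvg; rewrite /Rintegral fineK //.
apply: integrable_fin_num => //; apply: le_integrable iS => //.
  exact: (emeasurable_fun_cvg _ _ mue cue).
move=> x Dx /=; rewrite lee_fin; apply: le_trans (ler_norm _).
have cn : `|u_ n x| @[n --> \oo] --> `|u x| by apply: cvg_norm; apply: cu.
rewrite -(cvg_lim (@Rhausdorff R) cn).
by apply: limr_le; [exact: cvgP cn|apply: nearW => n; apply: bu].
Qed.

Lemma Cintegral_dominated (h_ : nat -> T -> R[i]) h (S : R) :
  (forall n, Cmeasurable (h_ n)) -> (forall n x, D x -> `|h_ n x| <= S%:C) ->
  (forall x, D x -> Ccvg \oo (h_ ^~ x) (h x)) ->
  Ccvg \oo (fun n => Cintegral mu D (h_ n)) (Cintegral mu D h).
Proof.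
move=> mh bh ch; apply/CcvgP; split.
  apply: (@Rintegral_dominated (fun n x => complex.Re (h_ n x)) _ S).
  - by move=> n; case: (mh n).
  - by move=> x Dx; have /CcvgP[] := ch x Dx.
  by move=> n x Dx; rewrite -lecR; apply: le_trans (normc_ge_Re _) (bh _ _ Dx).
apply: (@Rintegral_dominated (fun n x => complex.Im (h_ n x)) _ S).
- by move=> n; case: (mh n).
- by move=> x Dx; have /CcvgP[] := ch x Dx.
by move=> n x Dx; rewrite -lecR; apply: le_trans (normc_ge_Im _) (bh _ _ Dx).
Qed.
End CIntegral.

(** * Selecting one frequency of a Fourier series by integration and averaging *)

Section Fourier.
Variable R : realType.
Local Notation leb := (@lebesgue_measure R).
Local Notation I01 := (`[0%R, 1%R[%classic : set R).

Lemma measurable_I01 : measurable I01. Proof. exact: measurable_itv. Qed.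

Lemma leb_I01 : leb I01 = 1%E.
Proof. by rewrite lebesgue_measure_itv /= lte_fin ltr01 sube0. Qed.

Lemma leb_I01_fin : (leb I01 < +oo)%E.
Proof. by rewrite leb_I01 ltry. Qed.

Lemma continuous_lin (g : R -> R) (w : R) : continuous g -> continuous (fun x => g (w * x)).
Proof.
move=> cg x; apply: continuous_comp; last exact: cg.
by apply: cvgM; [exact: cvg_cst|exact: cvg_id].
Qed.

Lemma continuous_e2pi (b : R) :
  continuous (fun x => complex.Re (e2pi (b * x))) /\
  continuous (fun x => complex.Im (e2pi (b * x))).
Proof.
split; rewrite /e2pi /=; under eq_fun do rewrite mulrA.
  exact: (continuous_lin (@continuous_cos R)).
exact: (continuous_lin (@continuous_sin R)).
Qed.

Lemma Cmeasurable_e2pi (D : set R) (b : R) : measurable D ->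
  Cmeasurable D (fun x => e2pi (b * x)).
Proof.
move=> mD; have [c1 c2] := continuous_e2pi b.
by split; apply: measurable_funTS; apply: continuous_measurable_fun.
Qed.

Lemma CmeasurableZ (D : set R) (c : R[i]) (h : R -> R[i]) : Cmeasurable D h ->
  Cmeasurable D (fun x => c * h x).
Proof.
case: c => a b [mr mi]; split.
  have -> : (fun x => complex.Re ((a +i* b) * h x)) =
      (fun x => a * complex.Re (h x) - b * complex.Im (h x)).
    by apply/funext => x; case: (h x).
  by apply: measurable_funB; apply: measurable_funM => //; exact: measurable_cst.
have -> : (fun x => complex.Im ((a +i* b) * h x)) =
    (fun x => a * complex.Im (h x) + b * complex.Re (h x)).
  by apply/funext => x; case: (h x).
by apply: measurable_funD; apply: measurable_funM => //; exact: measurable_cst.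
Qed.

Lemma Cmeasurable_sum (D : set R) (I : Type) (s : seq I) (h : I -> R -> R[i]) :
  (forall i, Cmeasurable D (h i)) -> Cmeasurable D (fun x => \sum_(i <- s) h i x).
Proof.
move=> mh; elim: s => [|i s [IH1 IH2]].
  by under eq_fun do rewrite big_nil; split; exact: measurable_cst.
under eq_fun do rewrite big_cons; have [m1 m2] := mh i; split.
  by under eq_fun do rewrite cReD; exact: measurable_funD.
by under eq_fun do rewrite cImD; exact: measurable_funD.
Qed.

Lemma Rintegral_I01_FTC (f F : R -> R) : continuous f ->
  (forall x, is_derive x (1 : R) F (f x)) ->
  \int[leb]_(x in I01) f x = F 1 - F 0.
Proof.
move=> cf dF; have ci : leb.-integrable `[0%R, 1%R] (EFin \o f).
  apply: continuous_compact_integrable; first exact: segment_compact.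
  exact: continuous_subspaceT.
rewrite Rintegral_itv_bndo_bndc; last first.
  by apply: integrableS ci => //; apply: subset_itv; rewrite bnd_simp.
rewrite /Rintegral (@continuous_FTC2 _ f F) ?ltr01 //.
- exact: continuous_subspaceT.
- have cF : continuous F.
    move=> x; apply: differentiable_continuous; apply/derivable1_diffP.
    by have [] := dF x.
  split; first by move=> x _; have [] := dF x.
    by apply: cvg_at_right_filter; apply: cF.
  by apply: cvg_at_left_filter; apply: cF.
by move=> x _; rewrite derive1E; have [] := dF x.
Qed.

Lemma Cintegral_e2pi (l : int) :
  Cintegral leb I01 (fun x => e2pi (l%:~R * x)) = (l == 0)%:R.
Proof.
have [->|l0] := eqVneq l 0.
  have -> : (fun x : R => e2pi (0%:~R * x)) = fun=> 1.
    by apply/funext => x; rewrite mul0r e2pi0.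
  by rewrite /Cintegral /= !Rintegral_cst //= leb_I01 /= mul0r mulr1.
pose w : R := 2 * pi * l%:~R.
have w0 : w != 0 by rewrite !mulf_eq0 !negb_or pnatr_eq0 intr_eq0 l0 (gt_eqF (pi_gt0 R)).
have [c1 c2] := continuous_e2pi l%:~R.
have e1 : cos w = 1.
  by have /(congr1 (@complex.Re R)) := e2pi_int (intr_int R l).
have e2 : sin w = 0.
  by have /(congr1 (@complex.Im R)) := e2pi_int (intr_int R l).
have d1 x : is_derive x (1 : R) (fun x => sin (w * x) / w) (cos (w * x)).
  apply: is_derive_eq.
  by rewrite /GRing.scale /=; field.
have d2 x : is_derive x (1 : R) (fun x => - cos (w * x) / w) (sin (w * x)).
  apply: is_derive_eq.
  by rewrite /GRing.scale /=; field.
have cc : continuous (fun x => cos (w * x)).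
  exact: (continuous_lin (@continuous_cos R)).
have cs : continuous (fun x => sin (w * x)).
  exact: (continuous_lin (@continuous_sin R)).
rewrite /Cintegral /=; under eq_Rintegral do rewrite mulrA -/w.
under [X in _ +i* X]eq_Rintegral do rewrite mulrA -/w.
rewrite (Rintegral_I01_FTC cc d1) (Rintegral_I01_FTC cs d2).
by rewrite !mulr1 !mulr0 e1 e2 sin0 cos0 !subrr.
Qed.

(** A geometric sum with ratio e(-b): its D-th power is 1 because b D is an integer, and the ratio
    itself is 1 only if b is an integer. *)
Lemma sum_e2pi (b : R) (D : nat) : b * D%:R \is a Num.int ->
  \sum_(j < D) e2pi (- (b * j%:R)) = if b \is a Num.int then D%:R else 0.
Proof.
move=> bD; have pE j : e2pi (- (b * j%:R)) = e2pi (- b) ^+ j.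
  by rewrite -e2piMn mulr_natr mulNrn.
under eq_bigr do rewrite pE.
case: ifPn => bi.
  by rewrite e2pi_int ?rpredN //; under eq_bigr do rewrite expr1n; rewrite sumr_const card_ord.
have ne : e2pi (- b) != 1.
  by apply: contra bi => /eqP /e2pi_eq1; rewrite rpredN.
have ne' : e2pi (- b) - 1 != 0 by rewrite subr_eq0.
apply: (mulfI ne'); rewrite -subrX1 mulr0 -pE; apply/eqP; rewrite subr_eq0.
by rewrite e2pi_int // rpredN.
Qed.

(** Absolute summability bounds all symmetric partial sums at once; the bound serves as dominating
    constant when the series is integrated term by term. *)
Lemma Csum_int_bound (u : int -> R[i]) (l : R[i]) : Csum_int u l ->
  exists S : R, forall m : nat, \sum_(i < m.*2.+1) complex.Re `|u (i%:Z - m%:Z)| <= S.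
Proof.
move=> [sm _]; exists (fine (\esum_(n in [set: int]) `|(complex.Re `|u n|)%:E|)%E).
move=> m; rewrite -lee_fin fineK; last first.
  by rewrite ge0_fin_numE // esum_ge0.
pose r := [seq (i : nat)%:Z - m%:Z | i : 'I_(m.*2.+1)].
have ru : uniq r.
  rewrite map_inj_uniq ?enum_uniq // => i j /addIr /eqP; rewrite eqz_nat => /eqP.
  exact: val_inj.
apply: le_trans (ereal_sup_ubound _); last first.
  by exists [set` r]; [split => //; exact: finite_seq|reflexivity].
rewrite -fsbig_seq // big_map big_enum /= sumEFin lee_fin; apply: ler_sum => i _.
exact: ler_norm.
Qed.

Lemma normc_cRe (z : R[i]) : (complex.Re `|z|)%:C = `|z|.
Proof. by rewrite normc_def. Qed.

(* Summing over j the exponentials e(- b n j) removes the n with b n not an integer, and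
   for integral b n only b n = 1 survives integration against e(- x). *)
Lemma fourier_average (a : int -> R[i]) (b : int -> R) (D : nat) (F : R -> R[i]) (n0 : int)
  (S : R) :
  (forall m : nat, \sum_(i < m.*2.+1) complex.Re `|a (i%:Z - m%:Z)| <= S) ->
  (forall n, b n * D%:R \is a Num.int) -> (forall n, b n = 1 -> n = n0) ->
  (forall x, Ccvg \oo (fun m : nat => \sum_(i < m.*2.+1)
    (a (i%:Z - m%:Z) * e2pi (b (i%:Z - m%:Z) * x))) (F x)) ->
  \sum_(j < D) Cintegral leb I01 (fun x => F (x - j%:R) * e2pi (- x))
  = if b n0 == 1 then D%:R * a n0 else 0.
Proof.
move=> hS bD bn0 hF.
pose term n j x := a n * e2pi (- (b n * j)) * e2pi ((b n - 1) * x).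
have termE n j x : a n * e2pi (b n * (x - j)) * e2pi (- x) = term n j x.
  rewrite /term -!mulrA -!e2piD; congr (_ * e2pi _); ring.
pose P m j x := \sum_(i < m.*2.+1) term (i%:Z - m%:Z) j x.
(* Limit and integral are exchanged by dominated convergence; the bound [S] is uniform in x because
   the exponentials have modulus 1. *)
have I (j : R) : Ccvg \oo (fun m => Cintegral leb I01 (P m j))
    (Cintegral leb I01 (fun x => F (x - j) * e2pi (- x))).
  apply: (@Cintegral_dominated _ _ _ leb I01 measurable_I01 leb_I01_fin _ _ S).
  - move=> m; apply: Cmeasurable_sum => i; apply: CmeasurableZ.
    exact: Cmeasurable_e2pi measurable_I01.
  - move=> m x _; apply: le_trans (ler_norm_sum _ _ _) _.
    apply: (@le_trans _ _ (\sum_(i < m.*2.+1) (complex.Re `|a (i%:Z - m%:Z)|)%:C)).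
      by apply: ler_sum => i _; rewrite normc_cRe !normrM !norm_e2pi !mulr1.
    by rewrite -rmorph_sum lecR.
  - move=> x _; have cv := hF (x - j).
    have -> : (fun m => P m j x) = (fun m : nat => (\sum_(i < m.*2.+1)
        (a (i%:Z - m%:Z) * e2pi (b (i%:Z - m%:Z) * (x - j)))) * e2pi (- x)).
      apply/funext => m; rewrite mulr_suml; apply: eq_bigr => i _.
      by rewrite termE.
    have c1 : Ccvg \oo (fun _ : nat => e2pi (- x)) (e2pi (- x)).
      by apply: Ccvg_near_cst; apply: nearW.
    exact: (CcvgM _ cv c1).
have iE n : Cintegrable leb I01 (fun x => e2pi ((b n - 1) * x)).
  apply: (@Cintegrable_bounded _ _ _ leb I01 measurable_I01 leb_I01_fin _ 1).
    exact: Cmeasurable_e2pi measurable_I01.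
  by move=> x _; rewrite norm_e2pi.
have cE n (j : R) : Cintegrable leb I01 (term n j) /\ Cintegral leb I01 (term n j) =
    a n * e2pi (- (b n * j)) * Cintegral leb I01 (fun x => e2pi ((b n - 1) * x)).
  exact: (@CintegralZ _ _ _ leb I01 measurable_I01 (a n * e2pi (- (b n * j))) _ (iE n)).
have iP m (j : R) : Cintegral leb I01 (P m j) =
    \sum_(i < m.*2.+1) Cintegral leb I01 (term (i%:Z - m%:Z) j).
  exact: (@Cintegral_sum _ _ _ leb I01 measurable_I01 _ _ _ (fun i => (cE _ j).1)).2.
have sE n : \sum_(j < D) Cintegral leb I01 (term n j%:R) = if b n == 1 then D%:R * a n else 0.
  under eq_bigr do rewrite (cE _ _).2 -mulrA mulrCA.
  rewrite -mulr_suml sum_e2pi //; case: ifPn => [/intrP[l bl]|bni].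
    have -> : (fun x => e2pi ((b n - 1) * x)) = (fun x => e2pi ((l - 1)%:~R * x)).
      by apply/funext => x; rewrite bl intrB.
    rewrite Cintegral_e2pi subr_eq0 bl -(eqr_int R) mulrCA.
    by case: eqP => _; rewrite ?mulr1 ?mulr0 // mulrC.
  rewrite mul0r; case: eqP => // b1; move: bni; rewrite b1.
  by rewrite (_ : 1 \is a Num.int) // (intr_int R 1).
(* Both sides are limits of the same sequence, which is constant once the symmetric range contains
   [n0], at position n0 + m. *)
apply: (@Ccvg_unique R nat \oo _ (fun m => \sum_(j < D) Cintegral leb I01 (P m j%:R))).
  by apply: Ccvg_sum => j; apply: I.
apply: Ccvg_near_cst; near=> m.
under eq_bigr do rewrite iP.
rewrite exchange_big /=.
under eq_bigr do rewrite sE.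
have mn : (`|n0| <= m)%N by near: m; exact: nbhs_infty_ge.
have lt : (absz (n0 + m%:Z)%R < m.*2.+1)%N by lia.
have e0 : (absz (n0 + m%:Z)%R)%:Z - m%:Z = n0 by lia.
rewrite (bigD1 (Ordinal lt)) //= e0 big1 ?addr0 // => i /negP ne.
case: eqP => // /bn0 ei; exfalso; apply: ne; apply/eqP/val_inj => /=.
lia.
Unshelve. all: by end_near.
Qed.
End Fourier.

(** * Haar measure of residue classes *)

Section Haar.
Variables (R : realType) (mu : probability Zhat_borel R) (hmu : is_haar mu).
Variables (D : nat) (hD : (0 < D)%N).
Implicit Types (j : int) (z : Zhat).

(** The coset j + D Zhat, in a form that is visibly a finite intersection of cylinders. *)
Definition residue_class j : set Zhat_borel :=
  [set z : Zhat | forall p : prime_t, (p %| D)%N ->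
     z p (logn p D) = (j %% (p ^ logn p D)%N)%Z].

Lemma measurable_residue_class j : measurable (residue_class j).
Proof.
pose C (p : prime_t) : set Zhat_borel :=
  [set z : Zhat | z p (logn p D) = (j %% (p ^ logn p D)%N)%Z].
have -> : residue_class j = \bigcap_(p in [set` primes_of D]) C p.
  apply/seteqP; split => z h p /= hp; apply: h => /=; last exact: primes_ofP.
  exact: mem_primes_of hp.
have mC (p : prime_t) : measurable (C p).
  by apply: sub_sigma_algebra; exists p, (logn p D), (j %% (p ^ logn p D)%N)%Z.
by rewrite bigcap_seq; apply: bigsetI_measurable => p _; exact: mC.
Qed.

(* Translation by 1 permutes the residue classes cyclically. *)
Lemma residue_classS j : mu (residue_class (j + 1)) = mu (residue_class j).
Proof.
rewrite -(hmu (fun=> 1) (measurable_residue_class j)); congr (mu _).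
apply/seteqP; split => z /=.
  move=> h; exists (fun p => z p - 1); last first.
    by apply: functional_extensionality_dep => p; rewrite addrC subrK.
  move=> p pD; rewrite residueB (h p pD) residue1 modzDml.
  by rewrite -modzDmr modzNm modzDmr addrK.
case=> w h <- p pD; by rewrite residueD (h p pD) residue1 modzDm addrC.
Qed.

Lemma residue_class_nat (j : nat) : mu (residue_class j) = mu (residue_class 0).
Proof. by elim: j => [//|j <-]; rewrite -addn1 PoszD residue_classS. Qed.

Lemma residue_class_cover z : exists j : 'I_D, residue_class (j : nat) z.
Proof.
(* Chinese remainder idempotents: 1 modulo q^e and 0 modulo the rest of D, so that [s] is an integer
   with the residues of [z]. *)
pose idem q := zchinese (q ^ logn q D)%N%:Z (D %/ q ^ logn q D)%N%:Z 1 0.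
pose s := \sum_(q <- primes_of D) z q (logn q D) * idem q.
have hs (p : prime_t) : (p %| D)%N -> (s = z p (logn p D) %[mod (p ^ logn p D)%N])%Z.
  move=> pD; have pm := primes_ofP hD pD; have pP : prime p := valP p.
  apply/modz_eq_dvd; rewrite /s (bigD1_seq p pm (uniq_primes_of D)) /= addrAC.
  apply: rpredD.
    have -> : z p (logn p D) * idem p - z p (logn p D) = z p (logn p D) * (idem p - 1) by ring.
    apply: dvdz_mull; apply/modz_eq_dvd.
    by rewrite zchinese_modl // part_coprime.
  have idem0 (q : prime_t) : q != p ->
      (((p ^ logn p D)%N : int) %| z q (logn q D) * idem q)%Z.
    move=> qp; have qP : prime q := valP q.
    apply: dvdz_mull; apply: (@dvdz_trans (D %/ q ^ logn q D)%N).
      by rewrite dvdzE part_dvd_compl // eq_sym.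
    by apply/dvdz_mod0P; rewrite zchinese_modr ?mod0z // part_coprime.
  by apply: rpred_sum => q qp; exact: idem0.
have D0 : (D%:Z != 0) by rewrite eqz_nat -lt0n.
have jlt : (`|(s %% D)%Z|%N < D)%N.
  by rewrite -ltz_nat gez0_abs ?modz_ge0 // ltz_pmod.
exists (Ordinal jlt) => p pD /=; rewrite gez0_abs ?modz_ge0 //.
rewrite modz_dvdm ?hs ?residue_mod // dvdzE /=.
exact: pfactor_dvdnn.
Qed.

Lemma residue_class_inj (i j : 'I_D) z : residue_class (i : nat) z ->
  residue_class (j : nat) z -> i = j.
Proof.
move=> hi hj; apply/val_inj/eqP; rewrite -eqz_nat.
have : (i%:Z = j %[mod D])%Z.
  apply: (eq_modz_primes hD) => q qp qD.
  by have := hi (exist (fun q : nat => prime q) _ qp) qD; rewrite hj // => ->.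
by rewrite !modz_small ?ltz_nat /= => [->||].
Qed.

(** The D cosets partition Zhat and share one measure [m]; integrating the constant 1 then gives m =
    1/D. *)
Lemma Cintegral_residue (G : Zhat -> R[i]) (c : 'I_D -> R[i]) :
  (forall (j : 'I_D) z, residue_class (j : nat) z -> G z = c j) ->
  Cintegral mu setT (G : Zhat_borel -> R[i]) = D%:R^-1 * \sum_(j < D) c j.
Proof.
move=> hG; pose m : R := fine (mu (residue_class 0)).
pose ind (j : 'I_D) (z : Zhat_borel) : R[i] := (\1_(residue_class (j : nat)) z)%:C.
have indI (j : 'I_D) : Cintegrable mu setT (ind j).
  have muT : (mu setT < +oo)%E by rewrite probability_setT ltry.
  apply: (@Cintegrable_bounded _ _ _ mu setT measurableT muT _ 1).
  - by split; [exact: measurable_indic (measurable_residue_class _)|exact: measurable_cst].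
  - move=> z _; rewrite /ind normc_def /= expr0n addr0 sqrtr_sqr lecR indicE.
    by case: (_ \in _); rewrite ?normr1 ?normr0 ?ler01.
have indE (j : 'I_D) : Cintegral mu setT (ind j) = m%:C.
  rewrite /Cintegral /ind /Rintegral /= integral0 integral_indic //; last first.
    exact: measurable_residue_class.
  rewrite setIT; exact: (congr1 (fun v => (fine v)%:C) (residue_class_nat j)).
have main (G' : Zhat -> R[i]) c' : (forall (j : 'I_D) z, residue_class (j : nat) z -> G' z = c' j) ->
    Cintegral mu setT (G' : Zhat_borel -> R[i]) = m%:C * \sum_(j < D) c' j.
  move=> hG'; have -> : Cintegral mu setT (G' : Zhat_borel -> R[i]) =
      Cintegral mu setT (fun z => \sum_(j < D) c' j * ind j z).
    apply: eq_Cintegral => z _; have [j jz] := residue_class_cover z.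
    rewrite (hG' _ _ jz) (bigD1 j) //= big1 => [|i ij].
      by rewrite /ind indicE mem_set //= mulr1 addr0.
    rewrite /ind indicE memNset ?mulr0 // => iz.
    by move/eqP: ij; apply; exact: residue_class_inj iz jz.
  have h (j : 'I_D) := @CintegralZ _ _ _ mu setT measurableT (c' j) _ (indI j).
  rewrite (@Cintegral_sum _ _ _ mu setT measurableT _ _ _ (fun j : 'I_D => (h j).1)).2.
  by rewrite mulr_sumr; apply: eq_bigr => j _; rewrite (h j).2 indE mulrC.
have m1 : m%:C * D%:R = 1.
  have := main (fun=> 1) (fun=> 1) (fun _ _ _ => erefl).
  rewrite sumr_const card_ord => <-.
  transitivity ((1 * fine (mu setT)) +i* (0 * fine (mu setT))).
    by rewrite /Cintegral /= !Rintegral_cst.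
  by rewrite probability_setT /= mul0r mulr1.
have D0 : (D%:R : R[i]) != 0 by rewrite pnatr_eq0 -lt0n.
by rewrite (main _ _ hG); congr (_ * _); apply: (mulIf D0); rewrite m1 mulVf.
Qed.
End Haar.

(** * The Whittaker function at a cusp *)

Section AdelicIntegrand.
Variable R : realType.

Lemma scale_denominators (K : fieldType) (w n d u s l : K) :
  s != 0 -> n != 0 -> d != 0 -> u != 0 -> l != 0 ->
  w / (n / d) / u = w / (s * n * u * l) * (s * d * l).
Proof. by move=> s0 n0 d0 u0 l0; field; rewrite s0 n0 d0 u0 l0. Qed.

Lemma conj_unipotent (K : comNzRingType) (a b c d t : K) : a * d - b * c = 1 ->
  mx2 a b c d *m mx2 1 t 0 1 *m mx2 d (- b) (- c) a =
  mx2 (1 - a * c * t) (a * a * t) (- (c * c * t)) (1 + a * c * t).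
Proof.
move=> e; rewrite !mx2_mul; congr mx2; first 2 last.
- ring.
- by transitivity (a * d - b * c + a * c * t); [ring|rewrite e].
- by transitivity (a * d - b * c - a * c * t); [ring|rewrite e].
- ring.
Qed.

Lemma det_conj_unipotent (K : comNzRingType) (a c t : K) :
  (1 - a * c * t) * (1 + a * c * t) - a * a * t * - (c * c * t) = 1.
Proof. by ring. Qed.

(** Moves the conjugate [g *m t *m a] of the unipotent [t] next to [x], where K_0(N) absorbs it. *)
Lemma mulmx_conj_shift (K : comNzRingType) (u d a c g t x : 'M[K]_2) :
  a *m g = 1 -> u *m d = c *m t -> u *m (d *m a *m x) = c *m a *m 1 *m (g *m t *m a *m x).
Proof. by move=> ag ud; rewrite mulmx1 !mulmxA ud -(mulmxA c a) ag mulmx1. Qed.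

Lemma mul_div_shift (K : fieldType) (a w j : K) : a != 0 -> a * ((w - j) / a) + j = w.
Proof. by move=> a0; field. Qed.

(** The representative r is integral at p because x is, and at the other primes because its
    denominator is a power of p; an integer in [0, 1) is 0. The default value of [xget] is 0 as
    well. *)
Lemma padic_frac_int (p : prime_t) (x : padic p) : is_padic_int p x -> padic_frac x = 0.
Proof.
move=> xZ; rewrite /padic_frac; case: xgetP => // r _ [/andP[r0 r1] [n rn] xr].
have rZ : is_padic_int p (qp p r).
  by rewrite -[qp p r](subKr x); exact: (ZpB xZ xr).
have ri : r \is a Num.int.
  apply: rat_int_of_padic => q; have [qp|qp] := eqVneq q p.
    by rewrite qp.
  move: rn => /intrP[a ha]; have -> : r = a%:~R / (p ^ n)%:R.
    by rewrite -ha mulfK // pnatr_eq0 -lt0n expp_gt0.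
  rewrite fmorph_div rmorph_int rmorph_nat; apply: ZpM; first exact: Zp_int.
  apply: Zp_natV; apply: coprimeXl.
  by rewrite prime_coprime ?(valP p) // dvdn_prime2 ?(valP p) ?(valP q) // eq_sym.
move: ri r0 r1 => /intrP[m ->]; rewrite ler0z ltrz1 => m0 m1.
by have -> : m = 0 by lia.
Qed.

Lemma e_adele_Zhat (x : R) (z : Zhat) :
  e_adele (adele_opp (Adele x (fun p => to_padic (z p)))) = e2pi (- x).
Proof.
rewrite /e_adele /= fsbig1 ?mulr1 // => p _.
by rewrite /e_at padic_frac_int ?ratr0 ?rmorph0 ?oppr0 ?e2pi0 //; apply: ZpN; apply: Zp_to.
Qed.

Lemma Zp_residue_class (D : nat) (hD : (0 < D)%N) (j : int) (z : Zhat) (p : prime_t) :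
  residue_class D j z -> is_padic_int p ((to_padic (z p) - j%:~R) / D%:R).
Proof.
move=> hz; have D0 := @padic_natr_neq0 p _ hD; have pP : prime p := valP p.
have [pD|pD] := boolP (p %| D)%N.
  have [|y hy] := @padic_dvd_exp p (z p - j%:~R) (logn p D).
    by rewrite residueB hz // residue_intr subrr mod0z.
  have -> : to_padic (z p) - j%:~R = (p ^ logn p D)%:R * to_padic y.
    by rewrite -(rmorph_int (@to_padic p)) -rmorphB hy rmorphM rmorph_nat.
  have eD : D%:R = (p ^ logn p D)%:R * (D %/ p ^ logn p D)%:R :> padic p.
    by rewrite -[in LHS](part_div D pP) natrM.
  have pe0 := @padic_natr_neq0 p _ (expp_gt0 p (logn p D)).
  rewrite eD invfM mulrACA (divff pe0) mul1r.
  apply: ZpM; first exact: Zp_to.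
  exact/Zp_natV/coprime_cofactor.
apply: ZpM; first by apply: ZpB; [exact: Zp_to|exact: Zp_int].
by apply: Zp_natV; rewrite coprime_sym prime_coprime.
Qed.

Variables (N : nat) (hN : (0 < N)%N) (chi : dirichlet_char R N) (k : int) (f : R[i] -> R[i]).
Hypothesis hf : forall gam z, Gamma0 N gam -> 0 < complex.Im z ->
    slash k (int_mx R gam) f z = chi (gam 1 1) * f z.
Variables (gam : 'M[int]_2) (hgam : \det gam = 1).

(* The inverse of gam is its adjugate, as det gam = 1. *)
Definition cusp_adele (al : rat) (y : R) (kap : forall p, 'M[padic p]_2) : adelic_mx R :=
  AdelicMx (mx2 (ratr al * y) 0 0 1)
    (fun p => mx2 (qp p al) 0 0 1 *m map_mx intr (adj2 gam) *m kap p).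

Lemma intr_mx_adj (K : comNzRingType) :
  map_mx intr (adj2 gam) *m map_mx intr gam = 1 :> 'M[K]_2.
Proof. by rewrite -map_mxM adj2_mul hgam map_mx2 mx2_1. Qed.

(** Write n(t) for the unipotent matrix with upper entry t. Then n(z) d(al) = n(j) d(al) n(t) with t
    = (z - j) / al, and the modulus makes t divisible by N at every p. Hence gam n(t) gam^-1 lies in
    K_0(N) with lower right entry 1 modulo N, which chi does not see. The rational matrix n(j) d(al)
    gam^-1 is removed by left invariance and leaves (x - j) / al in the real component. *)
Lemma adelic_lift_cusp (al : rat) (y : R) kap (L : nat) (j : int) (z : Zhat) (x : R) :
  al != 0 -> 0 < y -> (0 < L)%N -> (forall p, K0p N (kap p)) ->
  residue_class (`|numq al| * N * L) j z ->
  adelic_lift chi k f (adelic_mul (unipotent (Adele x (fun p => to_padic (z p))))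
    (cusp_adele al y kap))
  = chi_K0 chi kap * slash k (int_mx R gam) f (((x - j%:~R) / ratr al) +i* y).
Proof.
move=> al0 y0 L0 kapK hz.
have D0 : (0 < `|numq al| * N * L)%N by rewrite !muln_gt0 hN L0 lt0n absz_eq0 numq_eq0 al0.
pose t p := (to_padic (z p) - j%:~R) / qp p al.
pose E p := map_mx intr gam *m mx2 1 (t p) 0 1 *m map_mx intr (adj2 gam) : 'M[padic p]_2.
have al0p p : qp p al != 0 by rewrite fmorph_eq0.
have alR : ratr al != 0 :> R by rewrite fmorph_eq0.
have tN p : is_padic_int p (t p / N%:R).
  have := @Zp_residue_class _ D0 _ _ p hz; rewrite /t.
  set w := to_padic _ - _; set D := muln _ _ => hw.
  have n0 : (numq al)%:~R != 0 :> padic p by rewrite padic_intrF_eq0 numq_eq0.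
  have d0 : (denq al)%:~R != 0 :> padic p by rewrite padic_intrF_eq0 denq_neq0.
  have N0 := @padic_natr_neq0 p _ hN.
  have eD : D%:R = (Num.sg (numq al))%:~R * (numq al)%:~R * N%:R * L%:R :> padic p.
    by rewrite /D !natrM -intrM -abszEsg pmulrn.
  have -> : w / qp p al / N%:R =
      w / D%:R * ((Num.sg (numq al))%:~R * (denq al)%:~R * L%:R).
    have -> : qp p al = (numq al)%:~R / (denq al)%:~R by [].
    have s0 : (Num.sg (numq al))%:~R != 0 :> padic p.
      by rewrite padic_intrF_eq0 sgr_eq0 numq_eq0.
    have LL0 := @padic_natr_neq0 p _ L0.
    rewrite eD.
    have := scale_denominators w s0 n0 d0 N0 LL0.
    exact.
  apply: ZpM => //; apply: ZpM; [apply: ZpM; exact: Zp_int|exact: Zp_nat].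
have tZ p : is_padic_int p (t p) := Zp_divN hN (tN p).
pose a p : padic p := (gam 0 0)%:~R; pose c p : padic p := (gam 1 0)%:~R.
have aZ p : is_padic_int p (a p) := Zp_int p _.
have cZ p : is_padic_int p (c p) := Zp_int p _.
have EE p : E p = mx2 (1 - a p * c p * t p) (a p * a p * t p)
    (- (c p * c p * t p)) (1 + a p * c p * t p).
  have dE : (gam 0 0)%:~R * (gam 1 1)%:~R - (gam 0 1)%:~R * (gam 1 0)%:~R = 1 :> padic p.
    by rewrite -!intrM -intrB -det2 hgam.
  rewrite /E (mx2_eta gam) /adj2 !map_mx2 !mx2E !(rmorphN intr) /=.
  exact: conj_unipotent dE.
have EK p : K0p N (E p).
  have acZ := ZpM (aZ p) (cZ p).
  rewrite EE; split; rewrite ?mx2E.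
  - exact: (ZpB (Zp1 p) (ZpM acZ (tZ p))).
  - exact: (ZpM (ZpM (aZ p) (aZ p)) (tZ p)).
  - rewrite mulNr -(mulrA (c p * c p)); exact: (ZpN (ZpM (ZpM (cZ p) (cZ p)) (tN p))).
  - exact: (ZpD (Zp1 p) (ZpM acZ (tZ p))).
  rewrite det_mx2 det_conj_unipotent.
  exact: Zp_unit1.
have chiE : chi_K0 chi E = 1.
  rewrite /chi_K0 big_seq big1 // => p /mem_primes_of pN.
  rewrite -(chi_idelic1 hN chi pN); apply: (chi_idelic_congr hN) => //.
    exact: Zp_unit1.
  rewrite EE mx2E addrAC subrr add0r -(mulrA (a p * c p)).
  exact: (ZpM (ZpM (aZ p) (cZ p)) (tN p)).
pose G := mx2 al j%:~R 0 1 *m map_mx intr (adj2 gam).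
pose g := int_mx R gam *m mx2 y ((x - j%:~R) / ratr al) 0 1.
have detadj (K : comNzRingType) : \det (map_mx intr (adj2 gam)) = 1 :> K.
  by rewrite det_map_mx det_mx2 mulrNN [gam 1 1 * _]mulrC -det2 hgam.
have G0 : \det G != 0 by rewrite det_mulmx detadj det_mx2 mulr1 mulr1 mulr0 subr0.
have g0 : 0 < \det g.
  by rewrite det_mulmx det_map_mx hgam det_mx2 mul1r mulr1 mulr0 subr0.
have -> : adelic_mul (unipotent (Adele x (fun p => to_padic (z p)))) (cusp_adele al y kap)
   = adelic_mul (adelic_mul (i_diag R G) (i_inf g)) (i_fin R (fun p => E p *m kap p)).
  rewrite /adelic_mul; apply: (f_equal2 (@AdelicMx R)); rewrite ?[mx_inf _]/= ?[mx_fin _]/=.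
    have -> : map_mx ratr G = mx2 (ratr al) j%:~R 0 1 *m map_mx intr (adj2 gam) :> 'M[R]_2.
      rewrite /G map_mxM map_mx2 /= ratr_int rmorph0 rmorph1; congr (_ *m _).
      by apply/matrixP => i1 i2; rewrite !mxE ratr_int.
    rewrite mulmx1 /g mulmxA -(mulmxA (mx2 _ _ _ _)) intr_mx_adj mulmx1 !mx2_mul.
    by congr mx2; field.
  apply: functional_extensionality_dep => p.
  have -> : map_mx (qp p) G = mx2 (qp p al) j%:~R 0 1 *m map_mx intr (adj2 gam).
    rewrite /G map_mxM map_mx2 /= qp_int rmorph0 rmorph1; congr (_ *m _).
    by apply/matrixP => i1 i2; rewrite !mxE qp_int.
  have adjK : map_mx intr (adj2 gam) *m map_mx intr gam = 1 :> 'M[padic p]_2.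
    exact: intr_mx_adj.
  have nD : mx2 1 (to_padic (z p)) 0 1 *m mx2 (qp p al) 0 0 1 =
      mx2 (qp p al) j%:~R 0 1 *m mx2 1 (t p) 0 1.
    rewrite !mx2_mul !mulr0 !mul0r !mulr1 !mul1r !addr0 !add0r /t.
    by rewrite (mul_div_shift _ _ (al0p p)).
  exact: mulmx_conj_shift adjK nD.
rewrite (adelic_liftE hN hf G0 g0 (fun p => K0pM hN (EK p) (kapK p))).
rewrite (chi_K0M hN chi EK kapK) chiE mul1r mulrC; congr (_ * _).
exact: slash_affine.
Qed.
End AdelicIntegrand.

Section WhittakerValue.
Variables (R : realType) (N : nat) (hN : (0 < N)%N) (chi : dirichlet_char R N).

Lemma cusp_width_gt0 (gam : 'M[int]_2) : (0 < cusp_width N gam)%N.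
Proof.
rewrite /cusp_width big_nat_cond; apply: (big_ind (fun v => 0 < v)%N) => // [x y x0 y0|m].
  by rewrite leq_min x0 y0.
by case/andP => /andP[].
Qed.

(** By Euler chi(d)^phi(N) = 1, so phi(N) clears the denominator of the cusp parameter. *)
Lemma cusp_param_torsion (gam : 'M[int]_2) :
  cusp_param chi gam * (totient N)%:R \is a Num.int.
Proof.
rewrite /cusp_param; case: xgetP => [m _ [_ hm]|_]; last by rewrite mul0r (intr_int R 0).
apply: e2pi_eq1; rewrite mulr_natr e2piMn -hm.
set d := cusp_gen N gam 1 1 in hm *.
have dN : coprimez d N by rewrite -(dchar_neq0 chi) hm e2pi_neq0.
have dX n : chi (d ^+ n) = chi d ^+ n.
  by elim: n => [|n IH]; rewrite ?expr0 ?dchar1 // !exprS dcharM IH.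
rewrite -dX -(dchar1 chi); apply: dchar_mod.
have [n hn] : exists n : nat, (d = n%:Z %[mod N])%Z.
  have N0 : (N%:Z != 0) by rewrite eqz_nat -lt0n.
  by exists `|(d %% N)%Z|%N; rewrite gez0_abs ?modz_ge0 // modz_mod.
rewrite -modzXm hn modzXm.
have nN : coprime n N.
  by move: dN; rewrite /coprimez -gcdz_modl hn gcdz_modl => /eqP[/eqP].
have pX : n%:Z ^+ totient N = (n ^ totient N)%N by rewrite -!natz natrX.
by rewrite pX modz_nat (Euler_exp_totient nN) -modz_nat.
Qed.

Variables (mu : probability Zhat_borel R) (hmu : is_haar mu).
Variables (W : R -> R[i] -> R -> R[i]) (k : int) (nu : R[i]) (f : R[i] -> R[i]).
Hypothesis hf : forall gam z, Gamma0 N gam -> 0 < complex.Im z ->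
    slash k (int_mx R gam) f z = chi (gam 1 1) * f z.
Variables (gam : 'M[int]_2) (hgam : \det gam = 1) (A : int -> R[i]).
Hypothesis hA : is_fourier chi W k nu f gam A.

Let m : R := (cusp_width N gam)%:R.

(** Up to a positive scalar, which acts trivially, the scaling matrix is gam composed with z ->
    mz. *)
Lemma slash_cusp_scaling (x y : R) :
  slash k (int_mx R gam) f (x +i* y) = slash k (cusp_scaling R N gam) f ((x / m) +i* (y / m)).
Proof.
have m0 : 0 < m by rewrite ltr0n cusp_width_gt0.
have s0 : 0 < Num.sqrt m by rewrite sqrtr_gt0.
have sE : m = Num.sqrt m * Num.sqrt m by rewrite -expr2 sqr_sqrtr // ltW.
rewrite -[LHS]slash_affine -[RHS]slash_affine /cusp_scaling -/m; have c0 : 0 < (Num.sqrt m)^-1 by rewrite invr_gt0.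
rewrite -[LHS](slash_scale _ _ _ _ c0) -!mulmxA.
have sn0 : Num.sqrt m != 0 by rewrite gt_eqF.
have half w : w * (Num.sqrt m)^-1 = Num.sqrt m * (w / m).
  have -> : w / m = w / (Num.sqrt m * Num.sqrt m) by rewrite -sE.
  by field.
have -> // : mx2 y x 0 1 *m mx2 (Num.sqrt m)^-1 0 0 (Num.sqrt m)^-1 =
  mx2 (Num.sqrt m) 0 0 (Num.sqrt m)^-1 *m mx2 (y / m) (x / m) 0 1.
rewrite !mx2_mul -!half.
by rewrite !(mulr0, mul0r, addr0, add0r, mul1r, mulr1).
Qed.

Lemma whittaker_cusp (al : rat) (y : R) kap : al != 0 -> 0 < y ->
  (forall p, K0p N (kap p)) ->
  whittaker_fun chi mu k f (cusp_adele gam al y kap) =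
  chi_K0 chi kap * (fourierB chi gam A al *
    W (Num.sg (ratr al) * k%:~R / 2) (nu - 2^-1) (4 * pi * `|ratr al| * y)).
Proof.
move=> al0 y0 kapK.
have m0 : 0 < m by rewrite ltr0n cusp_width_gt0.
have alR : ratr al != 0 :> R by rewrite fmorph_eq0.
(* Chosen to clear the denominators of all frequencies: (n + mu) / (m al) times D = |num al| N m
   phi(N) is an integer. *)
pose L := (cusp_width N gam * totient N)%N.
have L0 : (0 < L)%N by rewrite muln_gt0 cusp_width_gt0 totient_gt0.
pose D := (`|numq al| * N * L)%N.
have D0 : (0 < D)%N by rewrite muln_gt0 L0 andbT muln_gt0 hN andbT lt0n absz_eq0 numq_eq0.
pose mc := cusp_param chi gam.
pose t (n : int) : R := n%:~R + mc.
pose a (n : int) : R[i] := if t n == 0 then 0 else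
  A n * W (Num.sg (t n) * k%:~R / 2) (nu - 2^-1) (4 * pi * `|t n| * (y / m)).
(* The frequency in x of the n-th term. It is 1 exactly when n = m al - mu, the index that defines
   B(gam, al). *)
pose b (n : int) : R := t n / (m * ratr al).
pose F (x : R) := slash k (int_mx R gam) f ((x / ratr al) +i* y).
have hF x : Csum_int (fun n => a n * e2pi (b n * x)) (F x).
  rewrite /F slash_cusp_scaling; have := hA (x / ratr al / m) (divr_gt0 y0 m0).
  congr (Csum_int _ _); apply/funext => n /=; rewrite -/mc -/(t n) /a.
  case: ifP => _; first by rewrite mul0r.
  by congr (_ * e2pi _); rewrite /b; field; rewrite alR gt_eqF.
pose c := chi_K0 chi kap.
have bD n : b n * D%:R \is a Num.int.
  have rE : ratr al = (numq al)%:~R / (denq al)%:~R :> R by [].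
  have n0 : (numq al)%:~R != 0 :> R by rewrite intr_eq0 numq_eq0.
  have d0 : (denq al)%:~R != 0 :> R by rewrite intr_eq0 denq_neq0.
  have -> : b n * D%:R = t n * (totient N)%:R * N%:R * (Num.sg (numq al))%:~R * (denq al)%:~R.
    have eD : D%:R = (Num.sg (numq al))%:~R * (numq al)%:~R * N%:R * (m * (totient N)%:R) :> R.
      by rewrite /D !natrM -intrM -abszEsg pmulrn.
    by rewrite /b eD rE; field; rewrite n0 d0 gt_eqF.
  have tT : t n * (totient N)%:R \is a Num.int.
    by rewrite mulrDl rpredD ?cusp_param_torsion // rpredM ?intr_int ?intr_nat.
  apply: rpredM; last exact: intr_int.
  apply: rpredM; last exact: intr_int.
  by apply: rpredM; last exact: (intr_int R N).
have mal0 : m * ratr al != 0 by rewrite mulf_eq0 negb_or alR (gt_eqF m0).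
have bE n : b n = 1 -> t n = m * ratr al.
  by move=> h; rewrite -[LHS](divfK mal0) -/(b n) h mul1r.
(* When m al - mu is not an integer, no frequency is 1 and both sides vanish, so rounding does no
   harm. *)
pose n0 := Num.floor (m * ratr al - mc).
have bn0 n : b n = 1 -> n = n0.
  by move=> /bE tE; rewrite /n0 -tE /t addrK intrKfloor.
have [S hS] := Csum_int_bound (hF 0).
have ca l : \sum_(i < l.*2.+1) complex.Re `|c * a (i%:Z - l%:Z)| <= complex.Re `|c| * S.
  have cE z : complex.Re `|c * z| = complex.Re `|c| * complex.Re `|z|.
    by rewrite normrM -[in LHS](normc_cRe c) -[in LHS](normc_cRe z) /= mulr0 subr0.
  under eq_bigr do rewrite cE; rewrite -mulr_sumr; apply: ler_wpM2l.
    by rewrite -lecR normc_cRe; exact: (normr_ge0 c).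
  by have := hS l; under eq_bigr do rewrite mulr0 e2pi0 mulr1.
have cF x : Ccvg \oo (fun l : nat => \sum_(i < l.*2.+1)
    (c * a (i%:Z - l%:Z) * e2pi (b (i%:Z - l%:Z) * x))) (c * F x).
  have [_ cv] := hF x.
  have cc : Ccvg \oo (fun _ : nat => c) c by apply: Ccvg_near_cst; apply: nearW.
  have -> : (fun l : nat => \sum_(i < l.*2.+1)
      (c * a (i%:Z - l%:Z) * e2pi (b (i%:Z - l%:Z) * x))) = (fun l : nat => c *
      \sum_(i < l.*2.+1) (a (i%:Z - l%:Z) * e2pi (b (i%:Z - l%:Z) * x))).
    apply/funext => l; rewrite mulr_sumr; apply: eq_bigr => i _; exact/esym/mulrA.
  exact: (CcvgM _ cc cv).
have avg := @fourier_average R (fun n => c * a n) b D (fun x => c * F x) n0 _ ca bD bn0 cF.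
have -> : whittaker_fun chi mu k f (cusp_adele gam al y kap) =
    D%:R^-1 * \sum_(j < D) Cintegral (@lebesgue_measure R) `[0, 1[
      (fun x => c * F (x - j%:R) * e2pi (- x)).
  apply: (Cintegral_residue hmu D0) => j z jz; apply: eq_Cintegral => x _.
  cbv zeta; rewrite e_adele_Zhat (adelic_lift_cusp hN hf hgam x al0 y0 L0 kapK jz) -/c.
  by rewrite pmulrn.
rewrite avg /fourierB -/m -/mc -/n0.
have DR0 : (D%:R : R[i]) != 0 by rewrite pnatr_eq0 -lt0n.
case: eqP => [/bE tE|nb]; last first.
  rewrite ifF ?mul0r ?mulr0 //; apply/negP => /intrP[n hn]; apply: nb.
  rewrite /b /t /n0 hn intrKfloor -hn subrK.
  by apply: divff.
have -> : m * ratr al - mc \is a Num.int by rewrite -tE /t addrK intr_int.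
rewrite mulKf //; congr (_ * _); rewrite /a tE (negbTE mal0).
rewrite sgrM gtr0_sg // mul1r normrM gtr0_norm //; congr (_ * W _ _ _).
by field; rewrite gt_eqF.
Qed.
End WhittakerValue.

(** * Conjugating the diagonal torus into K_0(N) *)

Section CuspTorus.
Variables (N : nat) (hN : (0 < N)%N) (gam : 'M[int]_2) (hgam : \det gam = 1).

Definition torus_conj (p : prime_t) (v : padic p) : 'M[padic p]_2 :=
  map_mx intr gam *m mx2 v 0 0 1 *m map_mx intr (adj2 gam).

Lemma conj_diag (K : comNzRingType) (a b c d v : K) : a * d - b * c = 1 ->
  mx2 a b c d *m mx2 v 0 0 1 *m mx2 d (- b) (- c) a =
  mx2 (v + b * c * (v - 1)) (a * b * (1 - v)) (d * (c * (v - 1))) (1 + b * (c * (1 - v))).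
Proof.
move=> e; have e' : a * d = 1 + b * c by rewrite -e subrK.
rewrite !mx2_mul; congr mx2; first 2 last.
- by ring.
- by transitivity (a * d - b * c * v); [ring|rewrite e'; ring].
- by transitivity (a * d * v - b * c); [ring|rewrite e'; ring].
- by ring.
Qed.

Lemma torus_conjE (p : prime_t) (v : padic p) : torus_conj v =
  mx2 (v + (gam 0 1)%:~R * (gam 1 0)%:~R * (v - 1)) ((gam 0 0)%:~R * (gam 0 1)%:~R * (1 - v))
   ((gam 1 1)%:~R * ((gam 1 0)%:~R * (v - 1))) (1 + (gam 0 1)%:~R * ((gam 1 0)%:~R * (1 - v))).
Proof.
have dE : (gam 0 0)%:~R * (gam 1 1)%:~R - (gam 0 1)%:~R * (gam 1 0)%:~R = 1 :> padic p.
  by rewrite -!intrM -intrB -det2 hgam.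
rewrite /torus_conj (mx2_eta gam) /adj2 !map_mx2 !mx2E !(rmorphN intr) /=.
exact: conj_diag dE.
Qed.

(** Only the lower left entry carries a condition: the other entries are polynomials in v with
    integer coefficients, and the determinant is v. *)
Lemma torus_conj_K0 (p : prime_t) (v : padic p) : is_padic_unit p v ->
  is_padic_int p ((gam 1 1)%:~R * ((gam 1 0)%:~R * (v - 1)) / N%:R) ->
  K0p N (torus_conj v).
Proof.
move=> vu h; have vZ := Zp_unit_sub vu; have Z1 := Zp1 p.
have v1 := ZpB vZ Z1; have v2 := ZpB Z1 vZ.
have iZ := Zp_int p; split; last first.
- rewrite /torus_conj !det_mulmx det_mx2 !det_map_mx hgam.
  rewrite det_mx2 mulrNN [gam 1 1 * _]mulrC -det2 hgam.
  by rewrite mulr1 mulr0 subr0 mul1r mulr1.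
- rewrite torus_conjE mx2E; exact: (ZpD Z1 (ZpM (iZ _) (ZpM (iZ _) v2))).
- by rewrite torus_conjE mx2E.
- rewrite torus_conjE mx2E; exact: (ZpM (ZpM (iZ _) (iZ _)) v2).
rewrite torus_conjE mx2E; exact: (ZpD vZ (ZpM (ZpM (iZ _) (iZ _)) v1)).
Qed.

Lemma chi_torus_conj_low (R : realType) (chi : dirichlet_char R N) (p : prime_t)
  (v : padic p) : (p %| N)%N -> is_padic_int p ((gam 1 0)%:~R * (v - 1) / N%:R) ->
  chi_idelic chi (torus_conj v 1 1) = 1.
Proof.
move=> pN h; rewrite -(chi_idelic1 hN chi pN); apply: (chi_idelic_congr hN) => //.
  exact: Zp_unit1.
rewrite torus_conjE mx2E addrAC subrr add0r -opprB mulrN mulrN mulNr.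
by apply: ZpN; rewrite -mulrA; apply: (ZpM (Zp_int p _) h).
Qed.

(** When d vanishes modulo N at p, ad - bc = 1 gives bc = -1, and the lower right entry 1 + bc(1 -
    v) becomes v. *)
Lemma chi_torus_conj_up (R : realType) (chi : dirichlet_char R N) (p : prime_t)
  (v : padic p) : (p %| N)%N -> is_padic_unit p v ->
  is_padic_int p ((gam 1 1)%:~R / N%:R) ->
  chi_idelic chi (torus_conj v 1 1) = chi_idelic chi v.
Proof.
move=> pN vu h; apply: (chi_idelic_congr hN) => //.
have dE0 : (gam 0 0)%:~R * (gam 1 1)%:~R - (gam 0 1)%:~R * (gam 1 0)%:~R = 1 :> padic p.
  by rewrite -!intrM -intrB -det2 hgam.
have dE : (gam 0 1)%:~R * (gam 1 0)%:~R = (gam 0 0)%:~R * (gam 1 1)%:~R - 1 :> padic p.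
  have aux (K : comNzRingType) (x y : K) : x - y = 1 -> y = x - 1 by move=> <-; rewrite subKr.
  exact: aux dE0.
rewrite torus_conjE mx2E mulrA dE.
have aux (K : comNzRingType) (x y w : K) : 1 + (x * y - 1) * (1 - w) - w = x * (1 - w) * y.
  by ring.
rewrite aux -(mulrA ((gam 0 0)%:~R * (1 - v))).
exact: (ZpM (ZpM (Zp_int p _) (ZpB (Zp1 p) (Zp_unit_sub vu))) h).
Qed.

Lemma Zp_div_part (p : prime_t) (x : padic p) :
  is_padic_int p (x / (p ^ logn p N)%:R) -> is_padic_int p (x / N%:R).
Proof.
move=> h; have pP : prime p := valP p.
have eN : N%:R = (p ^ logn p N)%:R * (N %/ p ^ logn p N)%:R :> padic p.
  by rewrite -[in LHS](part_div N pP) natrM.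
rewrite eN invfM mulrA; apply: (ZpM h).
exact/Zp_natV/coprime_cofactor.
Qed.

Lemma Zp_div_part_int (p : prime_t) (a : int) : (((p ^ logn p N)%N : int) %| a)%Z ->
  is_padic_int p (a%:~R / N%:R).
Proof.
move=> /dvdzP[c ->]; apply: Zp_div_part; rewrite intrM mulfK; first exact: Zp_int.
by rewrite padic_intrF_eq0 -lt0n expp_gt0.
Qed.

(* This is what makes the case gcd(M, N/M) = 2 work: there c is divisible by 2^(e-1). *)
Lemma Zp_unit2_sub1 (p : prime_t) (v : padic p) : prime_val p = 2%N -> is_padic_unit p v ->
  is_padic_int p ((v - 1) / 2%:R).
Proof.
move=> p2 [z zu <-].
have [|y hy] := @padic_dvd_exp p (z - 1) 1.
  have : z \is a GRing.unit := zu.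
  rewrite padic_unitE residueB residue1.
  have := residue_mod z 1; rewrite expn1 p2 => <-.
  have : (z 1%N %% 2)%Z = 0 \/ (z 1%N %% 2)%Z = 1 by lia.
  by case=> ->.
have -> : to_padic z - 1 = 2%:R * to_padic y.
  by rewrite -(rmorph1 (@to_padic p)) -rmorphB hy rmorphM rmorph_nat p2.
rewrite mulrAC divff ?mul1r; first exact: Zp_to.
exact: padic_natr_neq0.
Qed.

Variables (a b : int) (hab : coprimez a b) (M : nat) (hM : M = gcdn N `|b|%N).
Hypothesis hMN : coprime M (N %/ M) \/
         [/\ gcdn M (N %/ M) = 2%N, (2 %| N %/ M)%N & ~~ (4 %| N %/ M)%N].
Hypothesis hcusp : gam 0 0 * b = gam 1 0 * a.
Hypothesis hrep : forall q : nat, prime q -> (q %| N)%N ->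
    exists2 g, cusp_reps q (logn q N) g & mx_congr (q ^ logn q N) gam g.

(** Both a/b and the first column of gam are in lowest terms and represent the same cusp. This lets
    valuations of M be read off from gam. *)
Lemma abs_b_gam : `|b|%N = `|gam 1%R 0%R|%N.
Proof.
have e : (`|gam 0%R 0%R| * `|b| = `|gam 1%R 0%R| * `|a|)%N by rewrite -!abszM hcusp.
have c1 : coprime `|gam 1%R 0%R|%N `|gam 0%R 0%R|%N.
  rewrite -coprimezE; apply/coprimezP; exists (- gam 0 1, gam 1 1) => /=.
  by rewrite -hgam det2; ring.
have c2 : coprime `|b|%N `|a|%N by rewrite -coprimezE coprimez_sym.
apply/eqP; rewrite eqn_dvd; apply/andP; split.
  by rewrite -(Gauss_dvdl _ c2) -e dvdn_mull.
by rewrite -(Gauss_dvdr _ c1) e dvdn_mulr.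
Qed.

(** Modulo p^e, the matrix [0, -1; 1, 0] gives the first alternative and the identity the second. In
    the remaining case c has valuation l with 1 <= l < e, so p divides both M and N/M. Hence their
    gcd is 2, p = 2 and e = l + 1, and the missing factor 2 of c(v - 1) comes from v - 1. *)
Lemma cusp_prime_case (p : prime_t) : (p %| N)%N ->
  is_padic_int p ((gam 1 1)%:~R / N%:R) \/
  (forall v : padic p, is_padic_unit p v -> is_padic_int p ((gam 1 0)%:~R * (v - 1) / N%:R)).
Proof.
move=> pN; have pP : prime p := valP p.
have [g [[->|->]|[c [l [/andP[l1 le] cp /andP[c1 cl] ->]]]] hg] := hrep pP pN.
- right=> v vu; rewrite mulrAC; apply: ZpM.
    by apply: Zp_div_part_int; have := hg 1 0; rewrite mx2_1 mx2E => /modz_eq_dvd; rewrite subr0.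
  by apply: ZpB; [exact: Zp_unit_sub|exact: Zp1].
- left; apply: Zp_div_part_int.
  by have := hg 1 1; rewrite mx2E => /modz_eq_dvd; rewrite subr0.
have hc := hg 1 0; rewrite mx2E in hc.
set e := logn p N in le cl hc.
have dvdc n : (n <= e)%N -> (p ^ n %| `|gam 1%R 0%R|)%N = (p ^ n %| c * p ^ l)%N.
  move=> ne; have /modz_eq_dvd h := hc.
  have {}h : (((p ^ n)%N : int) %| (gam 1 0 - (c * p ^ l)%N%:Z)%R)%Z.
    by apply: dvdz_trans h; exact: (dvdn_exp2l p ne).
  have h' := rpredDl ((c * p ^ l)%N : int) h; rewrite subrK in h'.
  by move: h'; rewrite !dvdzE.
have dl : (p ^ l %| `|gam 1%R 0%R|)%N by rewrite dvdc ?dvdn_mull // ltnW.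
have ndl : ~~ (p ^ l.+1 %| `|gam 1%R 0%R|)%N.
  rewrite dvdc // expnS dvdn_pmul2r ?expp_gt0 // -prime_coprime //.
  by rewrite coprime_sym.
have g0 : (0 < `|gam 1%R 0%R|)%N by rewrite lt0n; apply: contra ndl => /eqP ->; exact: dvdn0.
have vl : logn p `|gam 1%R 0%R| = l.
  by apply/eqP; rewrite eqn_leq leqNgt -!pfactor_dvdn // ndl dl.
have vM : logn p M = l.
  by rewrite hM abs_b_gam logn_gcd // vl (minn_idPr (ltnW le)).
have MN : (M %| N)%N by rewrite hM dvdn_gcdl.
have vNM : logn p (N %/ M) = (e - l)%N by rewrite logn_div // vM.
have M0 : (0 < M)%N by rewrite hM gcdn_gt0 hN.
have NM0 : (0 < N %/ M)%N by rewrite divn_gt0 // dvdn_leq.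
have pM : (p %| M)%N by rewrite -[X in (X %| _)%N]expn1 pfactor_dvdn // vM.
have pNM : (p %| N %/ M)%N.
  by rewrite -[X in (X %| _)%N]expn1 pfactor_dvdn // vNM subn_gt0.
have pg : (p %| gcdn M (N %/ M))%N by rewrite dvdn_gcd pM pNM.
have [g2 _ n4] : [/\ gcdn M (N %/ M) = 2%N, (2 %| N %/ M)%N & ~~ (4 %| N %/ M)%N].
  case: hMN => // /eqP g1; move: pg; rewrite g1 dvdn1 => /eqP p1.
  by move: pP; rewrite p1.
have p2 : prime_val p = 2%N.
  by apply/eqP; rewrite -dvdn_prime2 // -g2.
(* 4 does not divide N/M, whose valuation is e - l > 0. *)
have el : e = l.+1.
  have : ~~ (p ^ 2 %| N %/ M)%N by rewrite p2.
  by rewrite pfactor_dvdn // vNM -ltnNge => n2; clear -n2 le; lia.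
have [c' hc'] : exists c', gam 1 0 = c' * (p ^ l)%N%:Z by apply/dvdzP.
right=> v vu; apply: Zp_div_part; rewrite -/e el hc' expnS natrM intrM -pmulrn.
have aux (K : fieldType) (x y u w : K) : u != 0 -> y != 0 -> x * y * w / (u * y) = x * (w / u).
  by move=> u0 y0; field; rewrite u0 y0.
have u0 : (prime_val p)%:R != 0 :> padic p.
  by apply: padic_natr_neq0; rewrite p2.
have y0 := @padic_natr_neq0 p _ (expp_gt0 p l).
rewrite (aux _ _ _ _ _ u0 y0); apply: ZpM; first exact: Zp_int.
by rewrite p2; exact: Zp_unit2_sub1.
Qed.
End CuspTorus.

(** * Products over the primes *)

Section PrimeProducts.

Lemma fsprod_seq (K : comNzRingType) (s : seq prime_t) (F : prime_t -> K) : uniq s ->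
  (forall p, p \notin s -> F p = 1) ->
  \big[*%R/1]_(p \in [set: prime_t]) F p = \prod_(p <- s) F p.
Proof.
move=> us hF; rewrite (@fsbigE _ _ _ _ setT s F us) //; last by move=> p _; apply: hF.
by apply: eq_bigl => p; rewrite in_setT.
Qed.

Lemma mem_primes_below (n : nat) (p : prime_t) : (p \in primes_below n) = (p < n)%N.
Proof. by rewrite mem_pmap_sub mem_iota. Qed.

Lemma uniq_primes_below n : uniq (primes_below n).
Proof. by apply: pmap_sub_uniq; apply: iota_uniq. Qed.

Lemma primes_belowD n k : primes_below (n + k) = primes_below n ++ pmap insub (iota n k).
Proof. by rewrite /primes_below iotaD pmap_cat. Qed.

Lemma prod_primes_below_tail (K : comNzRingType) (u : prime_t -> K) (n1 n : nat) :
  (forall p : prime_t, (n1 <= p)%N -> u p = 1) -> (n1 <= n)%N ->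
  \prod_(p <- primes_below n) u p = \prod_(p <- primes_below n1) u p.
Proof.
move=> hu nn; rewrite -(subnKC nn) primes_belowD big_cat /=.
suff -> : \prod_(p <- pmap insub (iota n1 (n - n1))) u p = 1 by rewrite mulr1.
rewrite big_seq big1 // => p.
by rewrite mem_pmap_sub mem_iota => /andP[h _]; apply: hu.
Qed.

Variable R : realType.

Lemma Ccvg_prod_primes_triv (C L : R[i]) (u : prime_t -> R[i]) (n1 : nat) :
  (forall p : prime_t, (n1 <= p)%N -> u p = 1) ->
  Ccvg \oo (fun n => C * \prod_(p <- primes_below n) u p) L ->
  L = C * \prod_(p <- primes_below n1) u p.
Proof.
move=> hu cv; apply: (Ccvg_unique _ cv); apply: Ccvg_near_cst; near=> n.
by congr (_ * _); apply: prod_primes_below_tail => //; near: n; exact: nbhs_infty_ge.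
Unshelve. all: by end_near.
Qed.

(* Each large prime multiplies the partial product by w, so the limit is fixed by
   multiplication by w. *)
Lemma Ccvg_prod_primes_eq0 (C L w : R[i]) (u : prime_t -> R[i]) (n1 : nat) :
  w != 1 -> (forall p : prime_t, (n1 <= p)%N -> u p = w) ->
  Ccvg \oo (fun n => C * \prod_(p <- primes_below n) u p) L -> L = 0.
Proof.
move=> w1 hu cv; set s := fun n => _ in cv.
have step (p : prime_t) : (n1 <= p)%N -> s p.+1 = w * s p.
  move=> h; rewrite /s -addn1 primes_belowD big_cat /=.
  have -> : insub (prime_val p) = Some p by exact: valK.
  by rewrite /= big_seq1 hu // mulrA mulrC.
have cw : Ccvg \oo (fun _ : nat => w) w by apply: Ccvg_near_cst; apply: nearW.
have cws : Ccvg \oo (fun t => w * s t) (w * L) by exact: (CcvgM _ cw cv).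
suff : L = w * L.
  move/eqP; rewrite -subr_eq0 -{1}(mul1r L) -mulrBl mulf_eq0 subr_eq0 eq_sym (negbTE w1).
  by move/eqP.
apply/eqP; rewrite -subr_eq0 -normr_eq0; apply: contraT => ne.
have e0 : 0 < `|L - w * L| / 2 by rewrite divr_gt0 // lt_neqAle eq_sym ne normr_ge0.
have [m1 _ h1] := Ccvg_dist _ cv e0.
have [m2 _ h2] := Ccvg_dist _ cws e0.
(* At a prime q beyond all three thresholds, s(q + 1) = w s(q) is close to both L and w L. *)
have [q qm qP] := prime_above (n1 + m1 + m2).
pose p : prime_t := exist (fun q : nat => prime q) q qP.
have pE : prime_val p = q by [].
have := h1 p.+1; rewrite /= step ?pE; last by lia.
move=> /(_ _) d1; have {}d1 := d1 ltac:(lia).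
have d2 := h2 p; rewrite /= pE in d2; have {}d2 := d2 ltac:(lia).
have := le_lt_trans (ler_distD (w * s q) L (w * L)) (ltrD d1 _).
rewrite distrC => /(_ _ d2).
by rewrite -splitr ltxx.
Qed.
End PrimeProducts.

(** The normalised function tends to 1 at infinity, so w cannot vanish at large arguments. *)
Lemma whittaker_nonzero (R : realType) (al : R) (nu : R[i]) (w : R -> R[i]) :
  is_whittaker al nu w -> exists y, 0 < y /\ w (4 * pi * y) != 0.
Proof.
case=> _ _ cv; have /(_ _) h := Ccvg_dist _ cv ltr01.
have [y [y0 hy]] : exists y, 0 < y /\ w y != 0.
  have g0 : \forall y \near +oo%R, (0 : R) < y by exact: nbhs_pinfty_gt.
  have /filter_ex // : \forall y \near +oo%R, (0 : R) < y /\ w y != 0.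
  apply: filterS2 g0 h => y y0 h1.
  split=> //; apply/eqP => w0; move: h1.
  by rewrite w0 mul0r subr0 normr1 ltxx.
have pi4 : 0 < 4 * pi :> R by rewrite mulr_gt0 ?pi_gt0.
exists (y / (4 * pi)); split; first by rewrite divr_gt0.
by rewrite mulrC divfK // gt_eqF.
Qed.

(** * The character on the conjugated torus, and the local components of the evaluation point *)

Section CuspCharacter.
Variables (R : realType) (N : nat) (hN : (0 < N)%N) (chi : dirichlet_char R N).
Variables (gam : 'M[int]_2) (hgam : \det gam = 1).

(* The value of chi at the conjugate of d(x) by gam: chi_p(x) if gam = [0, -1; 1, 0]
   modulo p^e, where the lower right entry vanishes, and 1 otherwise. *)
Definition cusp_char (p : prime_t) (x : padic p) : R[i] :=
  if pselect (is_padic_int p ((gam 1 1)%:~R / N%:R)) then chi_idelic chi x else 1.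

Lemma cusp_charM (p : prime_t) (x y : padic p) : (p %| N)%N -> is_padic_unit p x ->
  is_padic_unit p y -> cusp_char (x * y) = cusp_char x * cusp_char y.
Proof.
move=> pN xu yu; rewrite /cusp_char; case: pselect => h; last by rewrite mulr1.
exact: chi_idelicM.
Qed.

Lemma cusp_char1 (p : prime_t) : (p %| N)%N -> cusp_char (1 : padic p) = 1.
Proof. by move=> pN; rewrite /cusp_char; case: pselect => h; [exact: chi_idelic1|]. Qed.

Lemma cusp_char_neq0 (p : prime_t) (x : padic p) : (p %| N)%N -> is_padic_unit p x ->
  cusp_char x != 0.
Proof.
move=> pN xu; rewrite /cusp_char; case: pselect => h; last exact: oner_neq0.
exact: chi_idelic_neq0.
Qed.

Lemma cusp_charV (p : prime_t) (x : padic p) : (p %| N)%N -> is_padic_unit p x ->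
  cusp_char x^-1 = (cusp_char x)^-1.
Proof.
move=> pN xu; have x0 := cusp_char_neq0 pN xu; have [xn0 _ _] := (Zp_unitP _).1 xu.
apply: (mulfI x0); rewrite -(cusp_charM pN xu (Zp_unitV xu)) divff // divff //.
exact: cusp_char1.
Qed.

Lemma Zp_unitXz (p : prime_t) (x : padic p) (n : int) : is_padic_unit p x ->
  is_padic_unit p (x ^ n).
Proof.
move=> xu; have h (j : nat) : is_padic_unit p (x ^+ j).
  elim: j => [|j IH]; first by rewrite expr0; exact: Zp_unit1.
  by rewrite exprS; apply: Zp_unitM.
case: n => j; first exact: h.
by rewrite NegzE -exprnN; apply: Zp_unitV.
Qed.

Lemma cusp_charXz (p : prime_t) (x : padic p) (n : int) : (p %| N)%N -> is_padic_unit p x ->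
  cusp_char (x ^ n) = cusp_char x ^ n.
Proof.
move=> pN xu; have h (j : nat) : cusp_char (x ^+ j) = cusp_char x ^+ j.
  elim: j => [|j IH]; first by rewrite !expr0 cusp_char1.
  by rewrite !exprS (cusp_charM pN xu (Zp_unitXz j xu)) IH.
case: n => j; first exact: h.
by rewrite NegzE -!exprnN (cusp_charV pN (Zp_unitXz j.+1 xu)) h.
Qed.

Lemma cusp_char_prod (p : prime_t) (s : seq prime_t) (P : pred prime_t)
  (x : prime_t -> padic p) : (p %| N)%N -> (forall q, P q -> is_padic_unit p (x q)) ->
  is_padic_unit p (\prod_(q <- s | P q) x q) /\
  cusp_char (\prod_(q <- s | P q) x q) = \prod_(q <- s | P q) cusp_char (x q).
Proof.
move=> pN hx; elim: s => [|q s [IH1 IH2]].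
  by rewrite !big_nil; split; [exact: Zp_unit1|exact: cusp_char1].
rewrite !big_cons; case: ifPn => // Pq; split; first exact: (Zp_unitM (hx _ Pq) IH1).
by rewrite (cusp_charM pN (hx _ Pq) IH1) IH2.
Qed.

Lemma Zp_unit_prime (p q : prime_t) : q != p -> is_padic_unit p ((prime_val q)%:R : padic p).
Proof.
move=> qp; rewrite pmulrn; apply/Zp_unit_int; rewrite coprimezE /=.
rewrite prime_coprime ?(valP q) // dvdn_prime2 ?(valP p) ?(valP q) //.
Qed.

Lemma K0p_away (p : prime_t) (g : 'M[padic p]_2) : ~~ (p %| N)%N ->
  (forall i j, is_padic_int p (g i j)) -> is_padic_unit p (\det g) -> K0p N g.
Proof.
move=> pN hg hd; split=> //; apply: ZpM => //.
by apply: Zp_natV; rewrite coprime_sym prime_coprime ?(valP p).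
Qed.

(** At p not dividing N, gam itself lies in the local compact group and is used to cancel gam^-1.
    The component left there is the identity when the exponent is 0, as membership in [GL2A] and the
    single value w require. *)
Definition cusp_torus (p : prime_t) (v : padic p) : 'M[padic p]_2 :=
  if (p %| N)%N then torus_conj gam v else map_mx intr gam *m mx2 v 0 0 1.

Definition cusp_component (p : prime_t) (n : int) : 'M[padic p]_2 :=
  if (p %| N)%N then mx2 (p%:R ^ n) 0 0 1 *m map_mx intr (adj2 gam)
  else mx2 (p%:R ^ n) 0 0 1.

Lemma cusp_torus_component (p : prime_t) (x v : padic p) (n : int) : x * v = p%:R ^ n ->
  mx2 x 0 0 1 *m map_mx intr (adj2 gam) *m cusp_torus v = cusp_component p n.
Proof.
move=> xv; have adjK : map_mx intr (adj2 gam) *m map_mx intr gam = 1 :> 'M[padic p]_2.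
  exact: intr_mx_adj.
have dd : mx2 x 0 0 1 *m mx2 v 0 0 1 = mx2 (p%:R ^ n) 0 0 1.
  by rewrite mx2_mul xv; congr mx2; rewrite !(mulr0, mul0r, addr0, add0r, mulr1).
rewrite /cusp_torus /cusp_component /torus_conj; case: ifP => _.
  by rewrite !mulmxA -(mulmxA (mx2 x _ _ _)) adjK mulmx1 dd.
by rewrite !mulmxA -(mulmxA (mx2 x _ _ _)) adjK mulmx1 dd.
Qed.

Hypothesis hcase : forall p : prime_t, (p %| N)%N ->
  is_padic_int p ((gam 1 1)%:~R / N%:R) \/
  (forall v : padic p, is_padic_unit p v -> is_padic_int p ((gam 1 0)%:~R * (v - 1) / N%:R)).

Lemma cusp_torus_K0 (p : prime_t) (v : padic p) : is_padic_unit p v -> K0p N (cusp_torus v).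
Proof.
move=> vu; rewrite /cusp_torus; case: ifPn => pN; last first.
  apply: K0p_away => //.
    move=> i j; rewrite mulmx2E; apply: ZpD; apply: ZpM; rewrite ?mxE; try exact: Zp_int.
      by case: (j == 0) => /=; [exact: Zp_unit_sub|exact: Zp0].
    by case: (j == 0) => /=; [exact: Zp0|exact: Zp1].
  by rewrite det_mulmx det_map_mx hgam det_mx2 mul1r mulr1 mulr0 subr0.
apply: torus_conj_K0 => //; have v1 := ZpB (Zp_unit_sub vu) (Zp1 p).
case: (hcase pN) => [h|h].
  by rewrite mulrAC; apply: (ZpM h (ZpM (Zp_int p _) v1)).
by rewrite -mulrA; apply: (ZpM (Zp_int p _) (h v vu)).
Qed.

Lemma chi_K0_cusp_torus (v : forall p : prime_t, padic p) :
  (forall p, is_padic_unit p (v p)) ->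
  chi_K0 chi (fun p => cusp_torus (v p)) = \prod_(p <- primes_of N) cusp_char (v p).
Proof.
move=> vu; rewrite /chi_K0; apply: eq_big_seq => p /mem_primes_of pN.
rewrite /cusp_torus pN /cusp_char; case: pselect => [h|h].
  exact: chi_torus_conj_up.
by apply: chi_torus_conj_low => //; case: (hcase pN) => // h'; apply: h'.
Qed.
End CuspCharacter.

(** The identity at p embeds as the same adelic matrix for every p. *)
Lemma whittaker_at1 (R : realType) (N : nat) (chi : dirichlet_char R N)
  (mu : probability Zhat_borel R) (k : int) (f : R[i] -> R[i]) W (nu : R[i]) (p q : prime_t) :
  whittaker_at chi mu k f W nu (1 : 'M[padic p]_2) =
  whittaker_at chi mu k f W nu (1 : 'M[padic q]_2).
Proof.
have i1 (r : prime_t) : i_at R (1 : 'M[padic r]_2) = i_fin R (fun=> 1).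
  rewrite /i_at; congr i_fin; apply: functional_extensionality_dep => r'.
  have [e|ne] := eqVneq r' r; last by rewrite dfwithout // eq_sym.
  by rewrite e dfwithin.
by rewrite /whittaker_at !i1.
Qed.

Lemma cusp_component0 (N : nat) (gam : 'M[int]_2) (p : prime_t) : ~~ (p %| N)%N ->
  cusp_component N gam p 0 = 1.
Proof. by rewrite /cusp_component => /negbTE ->; rewrite expr0z -mx2_1. Qed.

Lemma qp_expz (p : prime_t) (x : rat) (n : int) : qp p (x ^ n) = qp p x ^ n.
Proof.
case: n => n; first exact: rmorphXn.
by rewrite NegzE -!exprnN fmorphV rmorphXn.
Qed.

Lemma finite_support_bound (N : nat) (hN : (0 < N)%N) (e : prime_t -> int) :
  finite_set [set p | e p != 0] -> exists n1 : nat, forall p : prime_t, (n1 <= p)%N ->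
  e p = 0 /\ ~~ (p %| N)%N.
Proof.
move=> /finite_seqP[r er]; exists (N + \sum_(p <- r) prime_val p).+1 => p hp; split.
  apply/eqP; apply: contraT => ep; have pr : p \in r.
    by have : [set` r] p by rewrite -er.
  by move: hp; rewrite (big_rem p pr) /=; lia.
by apply/negP => /(dvdn_leq hN); lia.
Qed.

Theorem theorem35 (R : realType)
  (W : R -> R[i] -> R -> R[i])
  (hW : forall (al : R) (nu : R[i]), is_whittaker al nu (W al nu))
  (mu : probability Zhat_borel R) (hmu : is_haar mu)
  (k : int) (N : nat) (hN : (0 < N)%N) (chi : dirichlet_char R N) (nu : R[i])
  (a b : int) (hab : coprimez a b)
  (M : nat) (hM : M = gcdn N `|b|%N)
  (hMN : coprime M (N %/ M) \/
         [/\ gcdn M (N %/ M) = 2%N, (2 %| N %/ M)%N & ~~ (4 %| N %/ M)%N])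
  (gam : 'M[int]_2) (hgam : SL2Z gam)
  (hcusp : gam 0 0 * b = gam 1 0 * a)
  (hrep : forall q : nat, prime q -> (q %| N)%N ->
    exists2 g, cusp_reps q (logn q N) g & mx_congr (q ^ logn q N) gam g)
  (f : R[i] -> R[i]) (hf : is_maass chi k nu f)
  (hfact : whittaker_factors chi mu k f W nu)
  (A : int -> R[i]) (hA : is_fourier chi W k nu f gam A) :
  multiplicative_rat (fourierB chi gam A).
Proof.
have dg : \det gam = 1 := hgam.
have hcase := cusp_prime_case hN dg hab hM hMN hcusp hrep.
have hsl := maass_slash hf.
pose wp (p : prime_t) n := whittaker_at chi mu k f W nu (cusp_component N gam p n).
pose p2 : prime_t := exist (fun q : nat => prime q) 2%N isT.
pose w := whittaker_at chi mu k f W nu (1 : 'M[padic p2]_2).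
have wp0 (p : prime_t) : ~~ (p %| N)%N -> wp p 0 = w.
  by move=> pN; rewrite /wp (cusp_component0 _ pN); exact: (whittaker_at1 chi mu k f W nu p p2).
pose idx (eps : int) : R := Num.sg (eps%:~R : R) * k%:~R / 2.
(* One height per sign, fixed before al is known, so that dividing by [Wy eps] affects [hinf]
   only. *)
have [y hy] := choice (fun eps : int => whittaker_nonzero (hW (idx eps) (nu - 2^-1))).
pose Wy eps := W (idx eps) (nu - 2^-1) (4 * pi * y eps).
pose C eps := whittaker_fun chi mu k f (i_inf (mx2 (eps%:~R * y eps) 0 0 1)).
pose cp (p : prime_t) (x : rat) := cusp_char chi gam (qp p x).
pose hinf (eps : int) := \prod_(p <- primes_of N) cp p eps%:~R * C eps / Wy eps.
(* The prime q enters the p-unit part of al for every p <> q, so the character values at these p are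
   charged to q. *)
pose hp (q : prime_t) (n : int) := wp q n *
  \prod_(p <- primes_of N | p != q) cp p (prime_val q)%:R ^ n.
pose X eps e (s : seq prime_t) := \prod_(p <- primes_of N)
  (cp p eps%:~R * \prod_(q <- s | q != p) cp p (prime_val q)%:R ^ e q).
have key (eps : int) (e : prime_t -> int) (n1 : nat) : eps = 1 \/ eps = -1 ->
    (forall p : prime_t, (n1 <= p)%N -> e p = 0 /\ ~~ (p %| N)%N) ->
    let s := primes_below n1 in
    let al : rat := eps%:~R * \prod_(q <- s) (prime_val q)%:R ^ e q in
    X eps e s != 0 /\
    Ccvg \oo (fun n => C eps * \prod_(p <- primes_below n) wp p (e p))
      ((X eps e s)^-1 * (fourierB chi gam A al * Wy eps)).
  move=> heps hn1 s al.
  pose P : rat := \prod_(q <- s) (prime_val q)%:R ^ e q.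
  (* The p-unit part of al, sign included; its inverse is the torus element [v p] below. *)
  pose U (p : prime_t) : rat := eps%:~R * \prod_(q <- s | q != p) (prime_val q)%:R ^ e q.
  have alU p : al = U p * (prime_val p)%:R ^ e p.
    rewrite /al /U -mulrA; congr (_ * _); have [ps|ps] := boolP (p \in s).
      by rewrite (bigD1_seq p ps (uniq_primes_below _)) /= mulrC.
    have [-> _] : e p = 0 /\ ~~ (p %| N)%N by apply: hn1; rewrite leqNgt -mem_primes_below.
    rewrite expr0z mulr1 big_seq [RHS]big_seq_cond; apply: eq_bigl => q.
    by case qs : (q \in s) => //=; apply/esym; apply: contraNneq ps => <-.
  have epsu p : is_padic_unit p (qp p eps%:~R).
    rewrite qp_int; apply/Zp_unit_int; rewrite coprimezE.
    by case: heps => -> /=; rewrite coprime1n.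
  have qu (p q : prime_t) : q != p -> is_padic_unit p (qp p ((prime_val q)%:R ^ e q)).
    by move=> qp; rewrite qp_expz rmorph_nat; apply: Zp_unitXz; apply: Zp_unit_prime.
  have UE p : qp p (U p) =
      qp p eps%:~R * \prod_(q <- s | q != p) qp p ((prime_val q)%:R ^ e q).
    by rewrite rmorphM rmorph_prod.
  have Uu p : is_padic_unit p (qp p (U p)).
    rewrite UE; apply: Zp_unitM => //.
    apply: (big_ind (is_padic_unit p)); [exact: Zp_unit1|exact: Zp_unitM|exact: qu].
  pose v p := (qp p (U p))^-1.
  have vu p : is_padic_unit p (v p) := Zp_unitV (Uu p).
  have XE : chi_K0 chi (fun p => cusp_torus N gam (v p)) = (X eps e s)^-1.
    rewrite (chi_K0_cusp_torus hN chi dg hcase vu) /X -prodfV.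
    apply: eq_big_seq => p /mem_primes_of pN.
    rewrite (cusp_charV hN chi gam pN (Uu p)) UE; congr (_^-1).
    have [pu pE] := cusp_char_prod hN chi gam s pN (fun q => @qu p q).
    rewrite (cusp_charM hN chi gam pN (epsu p) pu) pE; congr (_ * _).
    apply: eq_bigr => q qp; rewrite qp_expz cusp_charXz //.
    by rewrite rmorph_nat; apply: Zp_unit_prime.
  have X0 : X eps e s != 0.
    rewrite -invr_eq0 -XE (chi_K0_cusp_torus hN chi dg hcase vu) prodf_seq_neq0.
    by apply/allP => p /mem_primes_of pN /=; apply: cusp_char_neq0.
  split=> //.
  have P0 : 0 < P.
    by apply: prodr_gt0 => q _; apply: exprz_gt0; rewrite ltr0n prime_gt0 // (valP q).
  have PR0 : 0 < ratr P :> R by rewrite ltr0q.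
  have e0 : eps%:~R != 0 :> rat by rewrite intr_eq0; case: heps => ->.
  have al0 : al != 0 by rewrite /al mulf_neq0 // gt_eqF.
  have [y0 _] := hy eps.
  (* At this height the real entry is eps y and the Whittaker argument 4 pi y, both free of al. *)
  have yy0 : 0 < y eps / ratr P by rewrite divr_gt0.
  have alE : ratr al = eps%:~R * ratr P :> R by rewrite rmorphM /= ratr_int.
  have val := whittaker_cusp hN hmu hsl dg hA al0 yy0
    (fun p => cusp_torus_K0 dg hcase (vu p)).
  have sgE : Num.sg (ratr al : R) = Num.sg (eps%:~R : R).
    by rewrite alE sgrM (gtr0_sg PR0) mulr1.
  have normE : `|ratr al : R| = ratr P.
    rewrite alE normrM (gtr0_norm PR0).
    by case: heps => ->; rewrite ?rmorphN ?normrN normr1 mul1r.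
  have gE : cusp_adele gam al (y eps / ratr P) (fun p => cusp_torus N gam (v p)) =
      AdelicMx (mx2 (eps%:~R * y eps) 0 0 1) (fun p => cusp_component N gam p (e p)).
    rewrite /cusp_adele; apply: (f_equal2 (@AdelicMx R)).
      by rewrite alE -mulrA [ratr P * _]mulrC divfK // gt_eqF.
    apply: functional_extensionality_dep => p; apply: cusp_torus_component => //.
    have [u0 _ _] := (Zp_unitP _).1 (Uu p).
    by rewrite (alU p) rmorphM /= /v mulrAC (divff u0) mul1r qp_expz rmorph_nat.
  have valE : whittaker_fun chi mu k f
      (AdelicMx (mx2 (eps%:~R * y eps) 0 0 1) (fun p => cusp_component N gam p (e p))) =
      (X eps e s)^-1 * (fourierB chi gam A al * Wy eps).
    rewrite -gE val XE sgE normE; congr (_ * (_ * W _ _ _)).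
    by rewrite -mulrA [ratr P * _]mulrC divfK // gt_eqF.
  pose g := AdelicMx (mx2 (eps%:~R * y eps) 0 0 1) (fun p => cusp_component N gam p (e p)).
  suff gA : GL2A g by rewrite -valE; exact: (hfact g gA).
  split.
  - rewrite -[mx_inf g]/(mx2 (eps%:~R * y eps) 0 0 1).
    rewrite det_mx2 mulr1 mulr0 subr0 mulf_eq0 negb_or (gt_eqF y0) andbT intr_eq0.
    by case: heps => ->.
  - move=> p; rewrite -[mx_fin g p]/(cusp_component N gam p (e p)).
    have p0 : (prime_val p)%:R ^ e p != 0 :> padic p.
      by apply: expfz_neq0; apply: padic_natr_neq0; rewrite prime_gt0 // (valP p).
    rewrite /cusp_component; case: ifP => _.
      rewrite det_mulmx !det_mx2 det_map_mx det_mx2 mulrNN [gam 1 1 * _]mulrC -det2 dg.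
      by rewrite !mulr1 mulr0 subr0.
    by rewrite det_mx2 mulr1 mulr0 subr0.
  apply: (@sub_finite_set _ _ [set` s]); last exact: finite_seq.
  move=> p np; rewrite /= mem_primes_below ltnNge; apply/negP => np1; apply: np.
  rewrite -[mx_fin g p]/(cusp_component N gam p (e p)).
  have [-> pN] := hn1 p np1; rewrite (cusp_component0 _ pN); split; last first.
    by rewrite det1; exact: Zp_unit1.
  move=> i j; rewrite mxE; case: (i == j); [exact: Zp1|exact: Zp0].
have alE (e : prime_t -> int) n1 :
    (forall p : prime_t, (n1 <= p)%N -> e p = 0 /\ ~~ (p %| N)%N) ->
    \big[*%R/1]_(p \in [set: prime_t]) (((prime_val p)%:R : rat) ^ e p) =
    \prod_(q <- primes_below n1) (prime_val q)%:R ^ e q.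
  move=> hn1; apply: fsprod_seq; first exact: uniq_primes_below.
  by move=> p; rewrite mem_primes_below -leqNgt => /hn1[-> _]; rewrite expr0z.
have huw (e : prime_t -> int) n1 :
    (forall p : prime_t, (n1 <= p)%N -> e p = 0 /\ ~~ (p %| N)%N) ->
    forall p : prime_t, (n1 <= p)%N -> wp p (e p) = w.
  by move=> hn1 p h; have [-> pN] := hn1 p h; exact: wp0.
have Wy0 eps : Wy eps != 0 by have [] := hy eps.
have [w1|w1] := eqVneq w 1; last first.
  (* For w <> 1 the coefficients vanish identically, and zero is multiplicative through its factor
     at infinity. *)
  exists (fun=> 0), (fun _ _ => 1); split.
    suff -> : [set p : prime_t | (1 : R[i]) != 1] = set0 by [].
    by apply/seteqP; split => p //=; rewrite eqxx.
  move=> eps e heps /(finite_support_bound hN)[n1 hn1]; rewrite mul0r (alE e n1 hn1).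
  have [X0 cv] := key eps e n1 heps hn1.
  have /eqP := Ccvg_prod_primes_eq0 w1 (huw e n1 hn1) cv.
  by rewrite !mulf_eq0 invr_eq0 (negbTE X0) (negbTE (Wy0 eps)) orbF => /eqP.
(* This is where w = 1 is used. *)
have hp0 (p : prime_t) : ~~ (p %| N)%N -> hp p 0 = 1.
  by move=> pN; rewrite /hp (wp0 p pN) w1 mul1r big1 // => q _; rewrite expr0z.
exists hinf, hp; split.
  apply: (@sub_finite_set _ _ [set` primes_of N]); last exact: finite_seq.
  move=> p /= hp1; apply: (primes_ofP hN); apply: contraT => pN.
  by move: hp1; rewrite (hp0 p pN) eqxx.
move=> eps e heps /(finite_support_bound hN)[n1 hn1]; rewrite (alE e n1 hn1).
have [X0 cv] := key eps e n1 heps hn1.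
have u1 (p : prime_t) : (n1 <= p)%N -> wp p (e p) = 1.
  by move=> h; rewrite (huw e n1 hn1 p h).
have lim := Ccvg_prod_primes_triv u1 cv.
have hpE : \big[*%R/1]_(p \in [set: prime_t]) hp p (e p) =
    \prod_(p <- primes_below n1) hp p (e p).
  apply: fsprod_seq; first exact: uniq_primes_below.
  by move=> p; rewrite mem_primes_below -leqNgt => /hn1[-> pN]; exact: hp0.
(* The character value, indexed by p | N, is regrouped by the primes q occurring in al, to match
   [hp]. *)
have XE : X eps e (primes_below n1) = \prod_(p <- primes_of N) cp p eps%:~R *
    \prod_(q <- primes_below n1) \prod_(p <- primes_of N | p != q) cp p (prime_val q)%:R ^ e q.
  rewrite /X big_split /=; congr (_ * _).
  under eq_bigr do rewrite big_mkcond; rewrite exchange_big /=.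
  apply: eq_bigr => q _; rewrite [RHS]big_mkcond; apply: eq_bigr => p _.
  by rewrite eq_sym.
rewrite hpE /hp big_split /= /hinf; apply: (mulIf (Wy0 eps)); apply: (mulfI (invr_neq0 X0)).
rewrite lim XE; set x1 := \prod_(p <- primes_of N) _; set x2 := \prod_(q <- _) \prod_(p <- _ | _) _.
set x3 := \prod_(p <- _) _; have x10 : x1 * x2 != 0 by rewrite -XE.
have := Wy0 eps; move: x10; rewrite mulf_eq0 negb_or => /andP[x10 x20] wy.
by field; rewrite wy x10 x20.
Qed.
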